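(* For all integers $t\geq s\geq 2$, ${\rm ex}(n,H_{s,t})=O\left(n^{2-2/(2s+1)}\right)$.
   Context: For integers $t\ge s\ge 2$, the graph $H_{s,t}$ is defined as follows: take an $s$-matching $a_1b_1,\dots,a_sb_s$ and a vertex-disjoint $t$-matching $c_1d_1,\dots,c_td_t$, and add all edges $a_id_j$ and $b_ic_j$ for $i\in[s]$, $j\in[t]$. (Equivalently, two vertex-disjoint copies of $K_{s,t}$ joined by a perfect matching connecting the two copies of each vertex; $H_{2,2}$ is the 3-dimensional cube.) ${\rm ex}(n,H)$ denotes the maximum number of edges in an $n$-vertex graph containing no copy of $H$ as a subgraph; the constant in $O(\cdot)$ may depend on $s,t$. *)

(* Defs.v *)
From mathcomp Require Import all_boot.

Set Implicit Arguments.
Unset Strict Implicit.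
Unset Printing Implicit Defensive.

(* A simple graph on the vertex type [V] is given by its edge set, a set of
   two-element subsets of [V]. *)
Definition is_graph (V : finType) (E : {set {set V}}) : bool :=
  [forall e in E, #|e| == 2].

Definition contains_copy (V W : finType)
    (G : {set {set V}}) (H : {set {set W}}) : bool :=
  [exists f : {ffun W -> V}, injectiveb f && [forall e in H, f @: e \in G]].

Definition ex_number (n : nat) (W : finType) (H : {set {set W}}) : nat :=
  \max_(G : {set {set 'I_n}} | is_graph G && ~~ contains_copy G H) #|G|.

Section Hst.
Variables s t : nat.

Definition Hst_vertex : finType := (('I_s + 'I_s) + ('I_t + 'I_t))%type.

Definition va (i : 'I_s) : Hst_vertex := inl (inl i).
Definition vb (i : 'I_s) : Hst_vertex := inl (inr i).
Definition vc (j : 'I_t) : Hst_vertex := inr (inl j).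
Definition vd (j : 'I_t) : Hst_vertex := inr (inr j).

Definition Hst : {set {set Hst_vertex}} :=
  [set [set va i; vb i] | i : 'I_s] :|:
  [set [set vc j; vd j] | j : 'I_t] :|:
  [set [set va i; vd j] | i : 'I_s, j : 'I_t] :|:
  [set [set vb i; vc j] | i : 'I_s, j : 'I_t].

End Hst.

(* Main.v *)
Require Import Defs.
From mathcomp Require Import all_boot zify.

Set Implicit Arguments.
Unset Strict Implicit.
Unset Printing Implicit Defensive.

(* Work with a bipartite relation E between A and B, e edges on at most n + n
   vertices and all degrees at most K e / n.  A copy of H_{s,t} is an s-matching
   (a_i b_i) together with t disjoint edges c_j d_j such that every a_i b_i c_j d_j
   is a 4-cycle.  Counting pairs (M, cd) of an s-matching M and an edge cd in 4-cycle
   position to all edges of M, convexity gives on average at least a constant times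
   e^(2s+1) / n^(4s) edges cd per M.  If they contain no t-matching, most of
   them lie in stars.  A star at c with many leaves d forces the (s+1)-set (c, a) to
   have many common neighbours; exchanging b_0 with d shows that such stars are
   rare provided the pairs (a_0, c) have codegree at most Y.
   If instead most 4-cycles use pairs of codegree above Y, then some c and some
   y > Y give a bipartite graph between N(c) and the vertices x with
   codeg(x, c) >= y that is so dense that the same double count,
   with the trivial bound for stars, already yields H_{s,t}.
   The degree condition is obtained from a minimal counterexample, and
   bipartiteness from a large cut. *)

(** * Power means and sums over tuples *)

Lemma leq_wexp2r (k m n : nat) : m <= n -> m ^ k <= n ^ k.
Proof. by case: k => // k h; rewrite leq_exp2r. Qed.

Lemma rearrangement_exp (a b k : nat) :
  a * b ^ k + b * a ^ k <= a ^ k.+1 + b ^ k.+1.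
Proof.
rewrite !expnS.
case/orP: (leq_total a b) => h.
  have : a ^ k <= b ^ k by apply: leq_wexp2r.
  nia.
have : b ^ k <= a ^ k by apply: leq_wexp2r.
nia.
Qed.
(** Doubled, both sides become double sums over (i, j), which compare term by term through
    [rearrangement_exp] with weight w_i w_j. *)
Lemma chebyshev_sum (I : finType) (w g : I -> nat) (k : nat) :
  (\sum_i w i * g i) * (\sum_i w i * g i ^ k) <=
  (\sum_i w i) * (\sum_i w i * g i ^ k.+1).
Proof.
rewrite -(leq_pmul2l (isT : 0 < 2)) !mul2n -!addnn.
rewrite !big_distrlr /= {1}exchange_big [X in _ <= X + _]exchange_big /=.
rewrite -!big_split /=; apply: leq_sum => i _.
rewrite -!big_split /=; apply: leq_sum => j _.
have := rearrangement_exp (g i) (g j) k.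
move=> /(leq_mul (leqnn (w i * w j))).
move: (g i ^ k) (g j ^ k) (g i ^ k.+1) (g j ^ k.+1) => x1 x2 x3 x4.
nia.
Qed.

(** Jensen's inequality for powers, cleared of denominators; each step of the induction is one use
    of Chebyshev. *)
Lemma power_mean (I : finType) (w g : I -> nat) (k : nat) :
  (\sum_i w i * g i) ^ k.+1 <= (\sum_i w i) ^ k * \sum_i w i * g i ^ k.+1.
Proof.
elim: k => [|k IH].
  by rewrite expn0 mul1n expn1; apply: leq_sum => i _; rewrite expn1.
rewrite expnS; apply: leq_trans (leq_mul (leqnn _) IH) _.
rewrite mulnCA (expnS (\sum_i w i)) (mulnC (\sum_i w i)) -mulnA.
by rewrite leq_mul2l chebyshev_sum orbT.
Qed.

(** Allows a loss q to be subtracted inside a power: x is at most twice the larger of x - q and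
    q. *)
Lemma leq_expn_subn (x q k : nat) : x ^ k <= 2 ^ k * ((x - q) ^ k + q ^ k).
Proof.
have h : x <= 2 * maxn (x - q) q by lia.
apply: (leq_trans (leq_wexp2r k h)).
rewrite expnMn leq_mul2l; apply/orP; right.
by case: (leqP (x - q) q) => _; [exact: leq_addl | exact: leq_addr].
Qed.

Lemma leq_expn_addn (x y k : nat) : (x + y) ^ k <= 2 ^ k * (x ^ k + y ^ k).
Proof. by have := leq_expn_subn (x + y) y k; rewrite addnK. Qed.

Lemma sum_ffun_prod (I T : finType) (F : I -> T -> nat) :
  \sum_(f : {ffun I -> T}) \prod_i F i (f i) = \prod_i \sum_x F i x.
Proof. by rewrite bigA_distr_bigA. Qed.

Lemma sum_ffun_expn (s : nat) (T : finType) (g : T -> nat) :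
  \sum_(f : {ffun 'I_s -> T}) \prod_i g (f i) = (\sum_x g x) ^ s.
Proof.
by rewrite (sum_ffun_prod (fun _ => g)) prod_nat_const card_ord.
Qed.

Lemma nat_of_forall (I : finType) (P : pred I) :
  nat_of_bool [forall i, P i] = \prod_i P i.
Proof.
case: forallP => [h|/forallP].
  by rewrite big1 // => i _; rewrite h.
rewrite negb_forall => /existsP [i /negbTE hi].
by rewrite (bigD1 i) //= hi.
Qed.

(** * Matchings among pairs *)

Lemma sum_ffun_point (s : nat) (T : finType) (S : pred T) (w : T -> nat) (q : nat)
    (i : 'I_s) :
  \sum_y S y * w y <= q ->
  \sum_(f : {ffun 'I_s -> T}) (\prod_k S (f k)) * w (f i) <=
  q * (\sum_y S y) ^ s.-1.
Proof.
move=> hq.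
pose F (k : 'I_s) (x : T) := S x * (if k == i then w x else 1).
rewrite (eq_bigr (fun f : {ffun _} => \prod_k F k (f k))); last first.
  move=> f _; rewrite /F big_split /=; congr (_ * _).
  by rewrite (bigD1 i) //= eqxx big1 ?muln1 // => k /negbTE ->.
rewrite sum_ffun_prod (bigD1 i) //= leq_mul //.
  by rewrite /F eqxx.
rewrite (eq_bigr (fun=> \sum_y S y)); last first.
  by move=> k /negbTE hk; apply: eq_bigr => y _; rewrite /F hk muln1.
by rewrite prod_nat_const cardC1 card_ord.
Qed.

(** With the value x of [f j] as an extra summation variable, the summand is a product over
    coordinates: x contributes the size of S, coordinate i at most q, and the other s - 2
    coordinates the size of S each. *)
Lemma sum_ffun_pair_point (s : nat) (T : finType) (S : pred T) (r : T -> T -> nat)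
    (q : nat) (i j : 'I_s) : i != j ->
  (forall x, S x -> \sum_y S y * r y x <= q) ->
  \sum_(f : {ffun 'I_s -> T}) (\prod_k S (f k)) * r (f i) (f j) <=
  q * (\sum_y S y) ^ s.-1.
Proof.
move=> nij hq.
pose F x (k : 'I_s) (y : T) :=
  S y * ((if k == i then r y x else 1) * (if k == j then (y == x : nat) else 1)).
rewrite (eq_bigr (fun f : {ffun _} => \sum_x \prod_k F x k (f k))); last first.
  move=> f _; rewrite (bigD1 (f j)) //= [X in _ + X]big1 ?addn0; last first.
    move=> x hx; rewrite (bigD1 j) //= /F eqxx [f j == x]eq_sym (negbTE hx).
    by rewrite !muln0.
  rewrite /F big_split /=; congr (_ * _).
  rewrite big_split /= (bigD1 i) //= eqxx big1 ?muln1; last first.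
    by move=> k /negbTE ->.
  rewrite (bigD1 j) //= !eqxx big1 ?muln1 // => k /negbTE -> //.
rewrite exchange_big /=.
under eq_bigr => x _ do rewrite sum_ffun_prod.
have s2 : s.-1 = (s.-2).+1.
  case: s i j nij {F} => [|[|s]] // i j.
    by case: i.
  by rewrite (ord1 i) (ord1 j).
rewrite s2 expnS mulnCA big_distrl /=.
apply: leq_sum => x _.
rewrite (bigD1 j) //= (bigD1 i) //=.
have -> : \sum_y F x j y = S x.
  rewrite /F (bigD1 x) //= !eqxx eq_sym (negbTE nij) !muln1 big1 ?addn0 //.
  by move=> y /negbTE ->; rewrite !muln0.
case hx : (S x); rewrite ?mul0n // leq_mul // leq_mul //.
  apply: leq_trans (hq x hx); apply: leq_sum => y _.
  by rewrite /F eqxx (negbTE nij) muln1.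
rewrite (eq_bigr (fun=> \sum_y S y)); last first.
  move=> k /andP [/negbTE hk /negbTE hk']; apply: eq_bigr => y _.
  by rewrite /F hk hk' !muln1.
rewrite prod_nat_const leq_eqVlt; apply/orP; left; apply/eqP; congr (_ ^ _).
have := cardD1 i (predC1 j); rewrite cardC1 card_ord s2 inE /= nij => -[->].
by apply: eq_card => k; rewrite !inE andbC.
Qed.

(** Union bound: with m the size of S, a tuple fails through one of s^2 events, each holding for at
    most q m^(s-1) tuples, and m^s - s^2 q m^(s-1) is at least the s-th power of the truncated
    difference m - s^2 q. *)
Lemma independent_tuples (s : nat) (T : finType) (S bad : pred T) (r : rel T)
    (q : nat) :
  (forall x, S x -> \sum_y S y * r y x <= q) -> \sum_y S y * bad y <= q ->
  (\sum_y S y - s ^ 2 * q) ^ s <=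
  \sum_(f : {ffun 'I_s -> T})
     ([forall i, S (f i) && ~~ bad (f i)] &&
      [forall i, forall j, (i != j) ==> ~~ r (f i) (f j)]).
Proof.
move=> hr hbad; set m := \sum_y S y; 
pose good (f : {ffun 'I_s -> T}) := [forall i, S (f i) && ~~ bad (f i)] &&
  [forall i, forall j, (i != j) ==> ~~ r (f i) (f j)].
rewrite -[X in _ <= X]/(\sum_f good f).
(* The diagonal i = j stands for a bad coordinate, so s^2 events cover all failures. *)
pose conf (i j : 'I_s) (f : {ffun 'I_s -> T}) :=
  (\prod_k S (f k)) * (if i == j then bad (f i) else r (f i) (f j)).
have hconf i j : \sum_f conf i j f <= q * m ^ s.-1.
  rewrite /conf; case: (eqVneq i j) => [_|nij].
    exact: (sum_ffun_point (w := bad)).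
  exact: (sum_ffun_pair_point (r := r)).
have hf (f : {ffun 'I_s -> T}) : \prod_k S (f k) <= good f + \sum_i \sum_j conf i j f.
  rewrite -nat_of_forall; case: forallP => [hS|] //.
  case hg : (good f); rewrite ?leq_addr // add0n.
  have hP : \prod_k S (f k) = 1 by rewrite big1 // => k _; rewrite hS.
  move: hg; rewrite /good => /negbT; rewrite negb_and.
  case/orP.
    rewrite negb_forall => /existsP [i]; rewrite hS /= negbK => hb.
    rewrite (bigD1 i) //= (bigD1 i) //= /conf eqxx hP hb; lia.
  rewrite negb_forall => /existsP [i]; rewrite negb_forall => /existsP [j].
  rewrite negb_imply negbK => /andP [nij hrij].
  rewrite (bigD1 i) //= (bigD1 j) //= /conf (negbTE nij) hP hrij; lia.
have {hf} htot : m ^ s <= \sum_f good f + s ^ 2 * (q * m ^ s.-1).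
  rewrite -sum_ffun_expn.
  apply: (@leq_trans (\sum_f (good f + \sum_i \sum_j conf i j f))).
    by apply: leq_sum => f _; exact: hf.
  rewrite big_split leq_add2l exchange_big /=.
  apply: (@leq_trans (\sum_(i < s) \sum_(j < s) q * m ^ s.-1)).
    by apply: leq_sum => i _; rewrite exchange_big /=; apply: leq_sum.
  by rewrite sum_nat_const sum_nat_const card_ord mulnA.
move: htot; move: (\sum_f good f) => G; case: s {conf hconf good} => [|s] htot.
  by rewrite expn0 in htot *; apply: leq_trans htot _; rewrite mul0n addn0.
case: (leqP m (s.+1 ^ 2 * q)) => h.
  by move: h; rewrite -subn_eq0 => /eqP ->; rewrite exp0n.
rewrite expnS; rewrite expnS /= in htot.
have [D hD] : exists D, m = D + s.+1 ^ 2 * q by exists (m - s.+1 ^ 2 * q); lia.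
have -> : m - s.+1 ^ 2 * q = D by rewrite hD addnK.
have : D ^ s <= m ^ s by apply: leq_wexp2r; rewrite hD leq_addr.
move: hD htot; move: (m ^ s) (D ^ s) (s.+1 ^ 2) => x1 x2 x3 ->.
nia.
Qed.

Lemma subset_of_card (T : finType) (X : {set T}) (k : nat) :
  k <= #|X| -> exists2 Z : {set T}, Z \subset X & #|Z| = k.
Proof.
move=> hk; exists [set x in take k (enum X)].
  by apply/subsetP => x; rewrite inE => /mem_take; rewrite mem_enum.
rewrite cardsE (card_uniqP _); first by rewrite size_takel // -cardE.
exact: take_uniq (enum_uniq _).
Qed.

Lemma sum_ffun_pair (I A B : finType) (F : {ffun I -> A * B} -> nat) :
  \sum_f F f =
  \sum_(a : {ffun I -> A}) \sum_(b : {ffun I -> B}) F [ffun i => (a i, b i)].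
Proof.
rewrite pair_big /=.
apply: (reindex (fun p : {ffun I -> A} * {ffun I -> B} => [ffun i => (p.1 i, p.2 i)])).
apply: onW_bij; exists (fun f : {ffun I -> A * B} => ([ffun i => (f i).1], [ffun i => (f i).2])).
  by move=> [a b]; congr (_, _); apply/ffunP => i; rewrite !ffunE.
by move=> f; apply/ffunP => i; rewrite !ffunE -surjective_pairing.
Qed.

(** Choosing a pair rules out at most 2L pairs of S, those sharing a coordinate with it. *)
Lemma greedy_matching (A B : finType) (L t : nat) (S : {set A * B}) :
  0 < L ->
  (forall a, \sum_b ((a, b) \in S) <= L) ->
  (forall b, \sum_a ((a, b) \in S) <= L) ->
  2 * L * t <= #|S| ->
  exists u : seq (A * B), [/\ size u = t, uniq (unzip1 u), uniq (unzip2 u) &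
    {subset u <= S}].
Proof.
move=> L0; elim: t S => [|t IH] S hA hB hS; first by exists [::].
have : 0 < #|S| by lia.
case/card_gt0P => -[a b] abS.
pose S' := [set p in S | (p.1 != a) && (p.2 != b)].
have sub a' b' : ((a', b') \in S') <= ((a', b') \in S).
  by rewrite inE; case: ((a', b') \in S) => /=; rewrite ?leq_b1.
have cS : #|S| <= #|S'| + 2 * L.
  rewrite mul2n -addnn.
  apply: (@leq_trans #|S' :|: ([set (a, y) | y in [set y | (a, y) \in S]] :|:
      [set (x, b) | x in [set x | (x, b) \in S]])|).
    apply/subset_leq_card/subsetP => -[x y] xyS; rewrite !inE xyS /=.
    case: (eqVneq x a) => [xa|_] /=.
      by apply/orP; left; apply/imsetP; exists y; rewrite ?inE -?xa.
    case: (eqVneq y b) => [yb|_] //=.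
    by apply/orP; right; apply/imsetP; exists x; rewrite ?inE -?yb.
  apply: leq_trans (leq_card_setU _ _) _; rewrite leq_add2l.
  apply: leq_trans (leq_card_setU _ _) _; apply: leq_add.
    apply: leq_trans (leq_imset_card _ _) _; apply: leq_trans (hA a).
    by rewrite -sum1dep_card big_mkcond; apply: leq_sum => y _; case: ifP.
  apply: leq_trans (leq_imset_card _ _) _; apply: leq_trans (hB b).
  by rewrite -sum1dep_card big_mkcond; apply: leq_sum => y _; case: ifP.
case: (IH S').
- by move=> a'; apply: leq_trans (hA a'); apply: leq_sum.
- by move=> b'; apply: leq_trans (hB b'); apply: leq_sum.
- lia.
move=> u [su u1 u2 uS].
exists ((a, b) :: u); split => /=.
- by rewrite su.
- rewrite u1 andbT; apply/negP => /mapP [p /uS]; rewrite inE => /andP [_ /andP [h _]] e.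
  by rewrite e eqxx in h.
- rewrite u2 andbT; apply/negP => /mapP [p /uS]; rewrite inE => /andP [_ /andP [_ h]] e.
  by rewrite e eqxx in h.
- move=> p; rewrite inE => /orP [/eqP -> //|/uS].
  by rewrite inE => /andP [].
Qed.

Lemma greedy_representatives (A B : finType) (P : A -> pred B) (cs : seq A) :
  (forall c, c \in cs -> size cs <= \sum_d P c d) ->
  exists u : seq (A * B), [/\ unzip1 u = cs, uniq (unzip2 u) &
    forall p, p \in u -> P p.1 p.2].
Proof.
elim: cs => [|c cs IH] h; first by exists [::].
case: IH => [c' hc'|u [u1 u2 uP]].
  by apply: leq_trans (h c' _); rewrite ?inE ?hc' ?orbT //= leqnSn.
have : 0 < #|[set d | P c d] :\: [set d in unzip2 u]|.
  rewrite cardsD subn_gt0.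
  apply: leq_ltn_trans (subset_leq_card (subsetIr _ _)) _.
  rewrite cardsE (card_uniqP u2) size_map -(size_map fst u) -[map _ u]/(unzip1 u) u1.
  apply: leq_trans (h c _) _; first by rewrite inE eqxx.
  by rewrite -sum1dep_card [X in _ <= X]big_mkcond; apply: leq_sum => d _; case: (P c d).
case/card_gt0P => d; rewrite !inE => /andP [hd Pd].
exists ((c, d) :: u); split => /=; rewrite ?u1 ?hd ?u2 //.
by move=> p; rewrite inE => /orP [/eqP -> //|/uP].
Qed.

(** * Linked edges and dense graphs *)

Lemma sum_prodE (A B : finType) (F : A * B -> nat) :
  \sum_p F p = \sum_x \sum_y F (x, y).
Proof. by rewrite pair_bigA; apply: eq_bigr => -[]. Qed.

Section Links.
Variables (A B : finType) (s : nat).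
Implicit Types (E : A -> B -> bool) (a : {ffun 'I_s -> A}) (b : {ffun 'I_s -> B}).

Definition matching E a b :=
  [&& injectiveb a, injectiveb b & [forall i, E (a i) (b i)]].

Definition link E a b (p : A * B) :=
  E p.1 p.2 &&
  [forall i, [&& E (a i) p.2, E p.1 (b i), a i != p.1 & b i != p.2]].

(* There is no copy of H_{s,t} with all a_i, c_j in A and all b_i, d_j in B; the
   sequence [u] lists the pairs (c_j, d_j). *)
Definition Hfree (t : nat) E :=
  forall a b (u : seq (A * B)), matching E a b -> size u = t ->
  uniq (unzip1 u) -> uniq (unzip2 u) -> ~~ all (link E a b) u.

Lemma star_pair (S : A * B -> bool) (r1 r2 : nat) (c : A) (d : B) :
  (forall x, \sum_y S (x, y) <= r1) -> (forall y, \sum_x S (x, y) <= r2) ->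
  \sum_p S p * ((p.1 == c) || (p.2 == d)) <= r1 + r2.
Proof.
move=> h1 h2.
apply: (@leq_trans (\sum_p (S p * (p.1 == c) + S p * (p.2 == d)))).
  by apply: leq_sum => p _; do !case: (_ == _); case: (S p).
rewrite big_split /=; apply: leq_add.
  apply: leq_trans (h1 c).
  rewrite sum_prodE /=.
  rewrite (bigD1 c) //= [X in _ + X]big1 ?addn0.
    by apply: leq_sum => y _; rewrite eqxx muln1.
  by move=> x /negbTE ->; rewrite big1 // => y _; rewrite muln0.
apply: leq_trans (h2 d).
rewrite sum_prodE exchange_big /=.
rewrite (bigD1 d) //= [X in _ + X]big1 ?addn0.
  by apply: leq_sum => y _; rewrite eqxx muln1.
by move=> x /negbTE ->; rewrite big1 // => y _; rewrite muln0.
Qed.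

(** The s-matchings linked to cd are independent tuples of pairs closing a 4-cycle with cd, where
    two pairs conflict if they share a vertex. At most r1 + r2 pairs meet a given pair, and this
    also bounds those through c or d. *)
Lemma matchings_lower E (Z : A * B -> bool) (c : A) (d : B) (r1 r2 : nat) :
  E c d ->
  (forall x, \sum_y [&& E x y, E x d, E c y & Z (x, y)] <= r1) ->
  (forall y, \sum_x [&& E x y, E x d, E c y & Z (x, y)] <= r2) ->
  (\sum_p [&& E p.1 p.2, E p.1 d, E c p.2 & Z p] - s ^ 2 * (r1 + r2)) ^ s <=
  \sum_a \sum_b [&& matching E a b, link E a b (c, d) &
                    [forall i, Z (a i, b i)]].
Proof.
move=> Ecd h1 h2.
pose S (p : A * B) := [&& E p.1 p.2, E p.1 d, E c p.2 & Z p].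
pose bad (p : A * B) := (p.1 == c) || (p.2 == d).
pose r (p q : A * B) := (p.1 == q.1) || (p.2 == q.2).
apply: leq_trans (@independent_tuples s _ S bad r (r1 + r2) _ _) _.
- by move=> [x y] _; apply: (star_pair (S := S)).
- exact: (star_pair (S := S)).
rewrite sum_ffun_pair; apply: leq_sum => a _; apply: leq_sum => b _.
case: andP => // -[/forallP hS /forallP hr] /=.
have hS' i : [&& E (a i) (b i), E (a i) d, E c (b i), Z (a i, b i), a i != c & b i != d].
  have := hS i; rewrite !ffunE /S /bad negb_or /=.
  by case/andP => /and4P [-> -> -> ->] /andP [-> ->].
have hr' i j : i != j -> (a i != a j) && (b i != b j).
  move=> nij; have /forallP /(_ j) := hr i.
  by rewrite nij !ffunE /r /= negb_or.
rewrite lt0b; apply/and3P; split.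
- apply/and3P; split; last by apply/forallP => i; case/and5P: (hS' i).
    apply/injectiveP => i j; apply: contra_eq => /hr' /andP [] //.
  apply/injectiveP => i j; apply: contra_eq => /hr' /andP [] //.
- rewrite /link Ecd /=; apply/forallP => i.
  by case/and5P: (hS' i) => _ -> -> _ ->.
- by apply/forallP => i; case/and5P: (hS' i).
Qed.

(** If t vertices c had t or more linked d each, distinct representatives would give a t-matching of
    links. So at most t such c exist, with their d among the common neighbours of the a_i; any other
    c has fewer than t links and is a common neighbour of the b_i. *)
Lemma sum_links_le t E a b : Hfree t E -> matching E a b ->
  \sum_c \sum_d link E a b (c, d) <=
  t * (\sum_d [forall i, E (a i) d]) + t * (\sum_c [forall i, E c (b i)]).
Proof.
move=> hH hM.
pose x c := \sum_d link E a b (c, d).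
pose X := [set c | t <= x c].
have cX : #|X| <= t.
  rewrite leqNgt; apply/negP => hX.
  have [Z sZ cZ] := subset_of_card (ltnW hX).
  have [] := @greedy_representatives _ _ (fun c d => link E a b (c, d)) (enum Z).
    by move=> c; rewrite mem_enum -cardE cZ => /(subsetP sZ); rewrite inE.
  move=> u [u1 u2 uP].
  have su : size u = t by rewrite -cZ cardE -u1 size_map.
  have := hH a b u hM su; rewrite u1 enum_uniq u2 => /(_ isT isT) /allP; apply.
  by move=> [c d] /uP.
rewrite (bigID (mem X)) /=; apply: leq_add.
  apply: (@leq_trans (\sum_(c in X) \sum_d [forall i, E (a i) d])).
    apply: leq_sum => c _; apply: leq_sum => d _.
    case: (boolP (link _ _ _ _)) => // /andP [_ /forallP h].
    by rewrite lt0b; apply/forallP => i; case/and4P: (h i).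
  by rewrite sum_nat_const leq_mul2r cX orbT.
rewrite big_distrr big_mkcond /=; apply: leq_sum => c _.
case: ifP => //; rewrite inE -ltnNge => /ltnW hc.
case: forallP => [h|h]; first by rewrite muln1.
rewrite big1 // => d _; case: (boolP (link _ _ _ _)) => // /andP [_ /forallP h'].
by case: h => i; case/and4P: (h' i).
Qed.

End Links.

(** The leading 2 pays for the absorption in [tot2]; the factors 2 ^ s and (2 * s ^ 2) ^ s come from
    the losses of [matchings_lower]. *)
Definition Kdense (s t : nat) := 2 * (2 ^ s * (t + (2 * s ^ 2) ^ s)).

(* Double count the pairs (M, cd) of an s-matching M and an edge cd linked to it.
   For fixed M at most t of the vertices c see t or more vertices d, so the linked
   edges number at most t times the common neighbours of both sides of M. *)
Lemma uniform_dense_bound (A B : finType) (s t y D : nat) (E : A -> B -> bool)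
    (F : {set A}) (N : {set B}) :
  0 < s -> 0 < y -> Hfree s t E ->
  (forall x, x \in F -> \sum_z E x z = y) ->
  (forall x z, E x z -> (x \in F) && (z \in N)) -> #|N| <= D ->
  Kdense s t * D ^ s <= y ^ s.+1 -> #|F| * y ^ s.+1 <= Kdense s t * D ^ s.+1.
Proof.
rewrite /Kdense => s0 y0 hH hy hE hN hD.
pose g d := \sum_a E a d.
pose G k := \sum_d g d ^ k.
pose m c d := \sum_p [&& E p.1 p.2, E p.1 d, E c p.2 & true].
have hyle x : \sum_z E x z <= y.
  case: (boolP (x \in F)) => [/hy -> //|/negP hx].
  by rewrite big1 // => z _; case: (boolP (E x z)) => // /hE /andP [].
pose T d := \sum_c E c d * \sum_(a : {ffun 'I_s -> A}) \sum_(b : {ffun 'I_s -> B})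
   [&& matching E a b, link E a b (c, d) & [forall i : 'I_s, true]].
have gN d : d \notin N -> g d = 0.
  move=> /negP hd; rewrite /g big1 // => x _.
  by case: (boolP (E x d)) => // /hE /andP [].
have sumN k : 0 < k -> \sum_d (d \in N) * g d ^ k = G k.
  move=> k0; apply: eq_bigr => d _.
  by case: (boolP (d \in N)) => [_|/gN ->]; rewrite ?mul1n // exp0n.
have cN : \sum_(d : B) (d \in N) <= D by rewrite -big_mkcond /= sum1_card.
have G1E : G 1 = #|F| * y.
  rewrite /G /g; under eq_bigr => d _ do rewrite expn1.
  rewrite exchange_big /= (bigID (mem F)) /= [X in _ + X]big1 ?addn0.
    by rewrite -sum_nat_const; apply: eq_bigr => x /hy.
  move=> x /negP hx; rewrite big1 // => z _.
  by case: (boolP (E x z)) => // /hE /andP [].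
(* With [h z] the number of common neighbours of z and d, the right-hand sum is the sum of
   [h z ^ 2]; this is Cauchy-Schwarz over the at most D vertices of [N]. *)
have step1 d : (g d * y) ^ 2 <= D * \sum_c E c d * m c d.
  pose h z := \sum_a E a d * E a z.
  have hN0 z k : 0 < k -> (z \in N) * h z ^ k = h z ^ k.
    move=> k0; case: (boolP (z \in N)) => [_|/negP hz]; rewrite ?mul1n //.
    rewrite /h big1 ?exp0n // => x _.
    by case: (boolP (E x z)) => [/hE /andP []|] //; rewrite muln0.
  have -> : \sum_c E c d * m c d = \sum_z (z \in N) * h z ^ 2.
    under [RHS]eq_bigr => z _ do rewrite hN0 // -mulnn /h big_distrlr /=.
    rewrite exchange_big /=; apply: eq_bigr => c _.
    rewrite /m sum_prodE exchange_big /= big_distrr /=; apply: eq_bigr => z _.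
    rewrite big_distrr /=; apply: eq_bigr => x _.
    by case: (E c d); case: (E c z); case: (E x d); case: (E x z).
  have -> : g d * y = \sum_z (z \in N) * h z.
    under [RHS]eq_bigr => z _ do rewrite -(expn1 (h z)) hN0 // expn1 /h.
    rewrite exchange_big /= /g big_distrl /=; apply: eq_bigr => x _.
    rewrite -big_distrr /=; case: (boolP (E x d)) => // /hE /andP [xF _].
    by rewrite hy.
  apply: leq_trans (power_mean _ _ 1) _.
  by rewrite expn1 leq_mul.
(* Power mean over the [g d] neighbours c of d, after which [g d ^ s.-1] cancels. *)
have step2 d : g d ^ s.+1 * y ^ (2 * s) <= D ^ s * \sum_c E c d * m c d ^ s.
  case: (posnP (g d)) => [->|gd0]; first by rewrite exp0n.
  have := leq_wexp2r s (step1 d); rewrite -expnM !expnMn.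
  have := @power_mean A (fun c => E c d) (fun c => m c d) s.-1.
  rewrite prednK // -/(g d) => /(leq_mul (leqnn (D ^ s))) h2 h1.
  have := leq_trans h1 h2; rewrite mulnCA.
  have -> : g d ^ (2 * s) = g d ^ s.-1 * g d ^ s.+1 by rewrite -expnD; congr (_ ^ _); lia.
  by rewrite -mulnA leq_pmul2l // expn_gt0 gd0.
have step3 d : \sum_c E c d * m c d ^ s <=
    2 ^ s * (T d + (2 * s ^ 2) ^ s * (g d * y ^ s + g d ^ s.+1)).
  pose q := s ^ 2 * (y + g d).
  apply: (@leq_trans (\sum_c 2 ^ s * (E c d * (m c d - q) ^ s + E c d * q ^ s))).
    apply: leq_sum => c _; case: (E c d) => //; rewrite !mul1n.
    exact: leq_expn_subn.
  rewrite -big_distrr leq_mul2l /= big_split /=; apply/orP; right; apply: leq_add.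
    apply: leq_sum => c _; case: (boolP (E c d)) => // Ecd; rewrite !mul1n.
    rewrite /m /q; refine (@matchings_lower A B s E (fun=> true) c d y (g d) Ecd _ _) => [x|z].
      by apply: leq_trans (hyle x); apply: leq_sum => z _; case: (E x z) => //; rewrite leq_b1.
    apply: leq_sum => x _; case: (E x d); rewrite ?andbF //; exact: leq_b1.
  rewrite -big_distrl /= -/(g d) /q [(s ^ 2 * _) ^ s]expnMn [(2 * _) ^ s]expnMn (expnS (g d) s).
  have /(leq_mul (leqnn (g d * (s ^ 2) ^ s))) := leq_expn_addn y (g d) s.
  move: ((y + g d) ^ s) (y ^ s) (g d ^ s) ((s ^ 2) ^ s) (2 ^ s); clear; nia.
(* The links are now counted by matchings, relaxed to tuples of edges. In the first term of
   [sum_links_le] each b_i has at most y choices given a_i; the second is a power mean over the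
   neighbours of c. *)
have step4 : \sum_d T d <= t * (y ^ s * G s) + t * (y ^ s.-1 * G s.+1).
  apply: (@leq_trans (\sum_(a : {ffun 'I_s -> A}) \sum_(b : {ffun 'I_s -> B})
      (matching E a b * \sum_c \sum_d link E a b (c, d)))).
    rewrite /T exchange_big /=.
    under [X in X <= _]eq_bigr => c _.
      under eq_bigr => d _.
        rewrite big_distrr /=; under eq_bigr => a _ do rewrite big_distrr /=.
        over.
      rewrite exchange_big /=; under eq_bigr => a _ do rewrite exchange_big /=.
      over.
    rewrite exchange_big /=; apply: leq_sum => a _.
    rewrite exchange_big /=; apply: leq_sum => b _.
    rewrite big_distrr /=; apply: leq_sum => c _.
    rewrite big_distrr /=; apply: leq_sum => d _.
    by case: (E c d); case: (matching E a b); case: (link _ _ _ _) => //=; case: [forall _, _].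
  pose P (a : {ffun 'I_s -> A}) (b : {ffun 'I_s -> B}) := \prod_i E (a i) (b i).
  have MP a b : matching E a b <= P a b.
    by rewrite /P -nat_of_forall /matching; case: [forall _, _]; rewrite ?andbF // leq_b1.
  apply: (@leq_trans (\sum_a \sum_b P a b *
     (t * (\sum_d \prod_i E (a i) d) + t * (\sum_c \prod_i E c (b i))))).
    apply: leq_sum => a _; apply: leq_sum => b _.
    have := MP a b; case: (boolP (matching E a b)) => // hM PM.
    apply: leq_mul => //; apply: leq_trans (sum_links_le hH hM) _.
    apply: leq_add; rewrite leq_mul2l; apply/orP; right.
      by apply: leq_sum => d _; rewrite nat_of_forall.
    by apply: leq_sum => d _; rewrite nat_of_forall.
  under eq_bigr => a _ do (under eq_bigr => b _ do rewrite mulnDr; rewrite big_split /=).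
  rewrite big_split /=; apply: leq_add.
    under eq_bigr => a _ do (under eq_bigr => b _ do rewrite mulnCA; rewrite -big_distrr /=).
    rewrite -big_distrr /= leq_mul2l; apply/orP; right.
    apply: (@leq_trans (\sum_(a : {ffun 'I_s -> A}) y ^ s * \sum_d \prod_i E (a i) d)).
      apply: leq_sum => a _; rewrite -big_distrl /= leq_mul2r; apply/orP; right.
      rewrite /P (sum_ffun_prod (fun i z => E (a i) z : nat)) -[s in y ^ s]card_ord -prod_nat_const.
      exact: leq_prod.
    rewrite -big_distrr leq_mul2l /=; apply/orP; right.
    rewrite exchange_big; apply: leq_sum => d _.
    by rewrite (sum_ffun_expn s (fun x => E x d : nat)).
  under eq_bigr => a _ do (under eq_bigr => b _ do rewrite mulnCA; rewrite -big_distrr /=).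
  rewrite -big_distrr /= leq_mul2l; apply/orP; right.
  rewrite exchange_big /=.
  apply: (@leq_trans (\sum_(b : {ffun 'I_s -> B}) \sum_c \prod_i (E c (b i) * g (b i)))).
    apply: leq_sum => b _; rewrite -big_distrl /=.
    rewrite big_distrr /=; apply: leq_sum => c _; rewrite big_split /= mulnC.
    by rewrite /P (sum_ffun_prod (fun i x => E x (b i) : nat)).
  rewrite exchange_big /=.
  apply: (@leq_trans (\sum_c y ^ s.-1 * \sum_z E c z * g z ^ s)).
    apply: leq_sum => c _; rewrite (sum_ffun_expn s (fun z => E c z * g z)).
    have := @power_mean B (fun z => E c z) g s.-1; rewrite prednK // => h.
    apply: (leq_trans h); rewrite leq_mul2r; apply/orP; right.
    exact: leq_wexp2r.
  rewrite -big_distrr leq_mul2l /= exchange_big /=; apply/orP; right.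
  by apply: leq_sum => z _; rewrite -big_distrl /= expnS.
have GS : #|F| * y * G s <= D * G s.+1.
  rewrite -G1E -!sumN //; under eq_bigr => d _ do rewrite expn1.
  by apply: leq_trans (chebyshev_sum _ _ _) _; rewrite leq_mul2r cN orbT.
have G1 : G 1 <= G s.
  by apply: leq_sum => d _; case: (g d) => // k; apply: leq_pexp2l.
pose k := 2 ^ s * (t + (2 * s ^ 2) ^ s).
have tot : y ^ (2 * s) * G s.+1 <= D ^ s * k * (y ^ s * G s + y ^ s.-1 * G s.+1).
  apply: (@leq_trans (D ^ s * \sum_d 2 ^ s * (T d + (2 * s ^ 2) ^ s * (g d * y ^ s + g d ^ s.+1)))).
    rewrite /G !big_distrr /=; apply: leq_sum => d _; rewrite mulnC.
    by apply: (leq_trans (step2 d)); rewrite leq_mul2l step3 orbT.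
  rewrite -mulnA leq_mul2l; apply/orP; right.
  rewrite -big_distrr /= /k -mulnA leq_mul2l; apply/orP; right.
  rewrite big_split /= -big_distrr /= big_split /= -big_distrl /=.
  have -> : \sum_d g d = G 1 by apply: eq_bigr => d _; rewrite expn1.
  rewrite -/(G s.+1).
  have : G s.+1 <= y ^ s.-1 * G s.+1 by rewrite leq_pmull // expn_gt0 y0.
  have : G 1 * y ^ s <= y ^ s * G s by rewrite mulnC leq_mul2l G1 orbT.
  move: step4; move: (\sum_d T d) (y ^ s * G s) (y ^ s.-1 * G s.+1) (G 1 * y ^ s) (G s.+1).
  move: ((2 * s ^ 2) ^ s); clear; nia.
(* By the density hypothesis the term with [y ^ s.-1 * G s.+1] is at most half of the left side and
   is absorbed. *)
have tot2 : y ^ (2 * s) * G s.+1 <= 2 * k * D ^ s * (y ^ s * G s).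
  have : 2 * k * D ^ s * (y ^ s.-1 * G s.+1) <= y ^ (2 * s) * G s.+1.
    have -> : 2 * s = s.+1 + s.-1 by lia.
    by rewrite expnD mulnA leq_mul2r leq_mul2r hD !orbT.
  by move: tot; move: (y ^ (2 * s) * G s.+1) (y ^ s * G s) (y ^ s.-1 * G s.+1) (D ^ s) k; clear; nia.
have tot3 : y ^ s * G s.+1 <= 2 * k * D ^ s * G s.
  move: tot2; rewrite mul2n -addnn expnD -mulnA [X in _ <= X]mulnCA leq_pmul2l //.
  by rewrite expn_gt0 y0.
case: (posnP (G s)) => [G0|G0].
  by move: G1; rewrite G0 leqn0 G1E expnS mulnA => /eqP ->.
rewrite -(leq_pmul2r G0).
have h1 := leq_mul (leqnn (y ^ s)) GS.
have h2 := leq_mul (leqnn D) tot3.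
rewrite expnS (expnS D); move: h1 h2; rewrite -/k.
move: (y ^ s) (G s) (G s.+1) (D ^ s); clear; nia.
Qed.

(** * Four-cycles with small codegrees *)

Definition codeg (A B : finType) (E : A -> B -> bool) (x x' : A) : nat :=
  \sum_z E x z * E x' z.

Definition transpose (A B : finType) (E : A -> B -> bool) (z : B) (x : A) : bool :=
  E x z.

Lemma matching_transpose (A B : finType) (s : nat) (E : A -> B -> bool)
    (a : {ffun 'I_s -> A}) (b : {ffun 'I_s -> B}) :
  matching (transpose E) b a = matching E a b.
Proof. by rewrite /matching andbCA. Qed.

Lemma link_transpose (A B : finType) (s : nat) (E : A -> B -> bool)
    (a : {ffun 'I_s -> A}) (b : {ffun 'I_s -> B}) (c : A) (d : B) :
  link (transpose E) b a (d, c) = link E a b (c, d).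
Proof.
congr (_ && _); apply: eq_forallb => i /=; rewrite /transpose.
by rewrite andbCA [in RHS]andbCA [(b i != d) && _]andbC; case: (E c _) => //=; case: (E _ d).
Qed.

Lemma Hfree_transpose (A B : finType) (s t : nat) (E : A -> B -> bool) :
  Hfree s t E -> Hfree s t (transpose E).
Proof.
move=> hH b a u; rewrite matching_transpose => hM su u1 u2.
pose v := [seq (p.2, p.1) | p <- u].
have := hH a b v hM; rewrite size_map su => /(_ erefl).
rewrite /unzip1 /unzip2 -!map_comp => /(_ u2 u1).
apply: contra => /allP hu; apply/allP => p /mapP [[d c] /hu hp ->].
by rewrite /= -link_transpose.
Qed.

Section Light.
Variables (A B : finType) (s t : nat) (E : A -> B -> bool) (D Y : nat).
Hypotheses (s0 : 0 < s) (hH : Hfree s t E).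
Hypothesis degA : forall x, \sum_z E x z <= D.
Hypothesis degB : forall z, \sum_x E x z <= D.

Definition update (T : finType) (i0 : 'I_s) (b : {ffun 'I_s -> T}) (z : T) :
  {ffun 'I_s -> T} := [ffun i => if i == i0 then z else b i].

(** Exchanging the entry of b at [i0] with z is an involution on the pairs (b, z). *)
Lemma sum_update (T : finType) (i0 : 'I_s) (F : {ffun 'I_s -> T} -> T -> nat) :
  \sum_b \sum_z F b z = \sum_b \sum_z F (update i0 b z) (b i0).
Proof.
rewrite !pair_bigA /=.
apply: (reindex (fun p => (update i0 p.1 p.2, p.1 i0))).
apply: onW_bij.
have K : involutive (fun p : {ffun 'I_s -> T} * T => (update i0 p.1 p.2, p.1 i0)).
  move=> [b z] /=; congr (_, _); last by rewrite ffunE eqxx.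
  by apply/ffunP => i; rewrite !ffunE; case: eqP => [->|].
by exists (fun p => (update i0 p.1 p.2, p.1 i0)).
Qed.

(** The surplus s leaves at least t common neighbours once the b_i are discarded. *)
Definition rich (a : {ffun 'I_s -> A}) (c : A) :=
  s + t < \sum_d [forall i, E (a i) d] && E c d.

(** Every common neighbour d of c and the a_i outside the b_i makes (c, d) a link, so t such centres
    would have distinct representatives and complete a copy. *)
Lemma rich_lt (a : {ffun 'I_s -> A}) (b : {ffun 'I_s -> B}) : matching E a b ->
  \sum_c ([forall i, E c (b i) && (a i != c)] && rich a c) <= t.
Proof.
move=> hM.
pose X := [set c | [forall i, E c (b i) && (a i != c)] && rich a c].
rewrite -big_mkcond /= sum1dep_card -/X leqNgt; apply/negP => hX.
have [Z sZ cZ] := subset_of_card (ltnW hX).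
have [] := @greedy_representatives _ _ (fun c d => link E a b (c, d)) (enum Z).
  move=> c; rewrite mem_enum -cardE cZ => /(subsetP sZ); rewrite inE.
  case/andP => /forallP hc; rewrite /rich => hr.
  have : \sum_d [forall i, E (a i) d] && E c d <=
         \sum_d link E a b (c, d) + \sum_d (d \in codom b).
    rewrite -big_split /=; apply: leq_sum => d _.
    case: (boolP (d \in codom b)) => hd; first exact: leq_trans (leq_b1 _) (leq_addl _ _).
    case: andP => // -[/forallP h1 h2]; rewrite addn0 lt0b.
    rewrite /link h2 /=; apply/forallP => i; rewrite h1 /=.
    case/andP: (hc i) => -> -> /=; apply: contra hd => /eqP <-.
    exact: codom_f.
  have : \sum_d (d \in codom b) <= s.
    rewrite -big_mkcond /= sum1_card; apply: leq_trans (card_size _) _.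
    by rewrite size_map -cardE card_ord.
  move=> h1 h2; rewrite -(leq_add2l s); apply: leq_trans (ltnW hr) _.
  by apply: leq_trans h2 _; rewrite addnC leq_add2r.
move=> u [u1 u2 uP].
have su : size u = t by rewrite -cZ cardE -u1 size_map.
have := hH hM su; rewrite u1 enum_uniq u2 => /(_ isT isT) /allP; apply.
by move=> [c d] /uP.
Qed.

(** Choose z = b_0, then s neighbours a_i of z, then the other s - 1 vertices b_i next to their
    a_i. *)
Lemma sum_pinned (i0 : 'I_s) :
  \sum_a \sum_(b : {ffun 'I_s -> B})
    (matching E a b && [forall i, E (a i) (b i0)]) <= #|B| * D ^ (2 * s).-1.
Proof.
apply: (@leq_trans (\sum_z \sum_(a : {ffun 'I_s -> A}) \sum_(b : {ffun 'I_s -> B})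
    (\prod_i E (a i) z) * \prod_i (E (a i) (b i) * (if i == i0 then (b i == z : nat) else 1)))).
  rewrite [X in _ <= X]exchange_big /=; apply: leq_sum => a _.
  rewrite [X in _ <= X]exchange_big /=; apply: leq_sum => b _.
  rewrite (bigD1 (b i0)) //=; apply: leq_trans (leq_addr _ _).
  case: andP => // -[/and3P [_ _ /forallP h1] /forallP h2].
  rewrite big1 ?mul1n => [|i _]; last by rewrite h2.
  rewrite big1 // => i _; rewrite h1 mul1n.
  by case: eqP => // ->; rewrite eqxx.
rewrite -sum_nat_const; apply: leq_sum => z _.
apply: (@leq_trans (\sum_(a : {ffun 'I_s -> A}) (\prod_i E (a i) z) * D ^ s.-1)).
  apply: leq_sum => a _; rewrite -big_distrr leq_mul2l /=; apply/orP; right.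
  rewrite (sum_ffun_prod (fun i y => E (a i) y * (if i == i0 then (y == z : nat) else 1))).
  rewrite (bigD1 i0) //= -[X in _ <= X]mul1n leq_mul //.
    rewrite (bigD1 z) //= !eqxx big1 ?addn0 ?muln1 ?leq_b1 //.
    by move=> y /negbTE ->; rewrite muln0.
  have -> : D ^ s.-1 = \prod_(i | i != i0) D.
    by rewrite prod_nat_const cardC1 card_ord.
  apply: leq_prod => i /negbTE ->; apply: leq_trans (degA (a i)).
  by apply: leq_sum => y _; rewrite muln1.
rewrite -big_distrl /= (sum_ffun_expn s (fun x => E x z : nat)).
have -> : (2 * s).-1 = s + s.-1 by lia.
by rewrite expnD leq_mul2r leq_wexp2r ?orbT.
Qed.

(* Exchanging b_0 with d turns the s-matching (a, b) into another one, for which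
   at most t centres c are rich; the old b_0 is a common neighbour of a_0 and c,
   hence one of at most Y vertices. *)
Lemma sum_rich_stars :
  \sum_a \sum_b \sum_c \sum_d
    [&& matching E a b, link E a b (c, d), [forall i, codeg E (a i) c <= Y]
      & rich a c] <= t * Y * #|B| * D ^ (2 * s).-1.
Proof.
pose i0 := Ordinal s0.
pose X a b := matching E a b && [forall i, E (a i) (b i0)].
pose R (a : {ffun 'I_s -> A}) (b : {ffun 'I_s -> B}) c :=
  [forall i, E c (b i) && (a i != c)] && rich a c.
apply: (@leq_trans (\sum_a \sum_b X a b * \sum_c R a b c * Y)); last first.
  apply: (@leq_trans (\sum_a \sum_b X a b * (t * Y))).
    apply: leq_sum => a _; apply: leq_sum => b _.
    case: (boolP (X a b)) => // /andP [hM _]; rewrite !mul1n.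
    by rewrite -big_distrl leq_mul2r /= (rich_lt hM) orbT.
  under eq_bigr => a _ do rewrite -big_distrl /=.
  rewrite -big_distrl /= -[X in _ <= X]mulnA [X in X <= _]mulnC.
  by rewrite leq_mul2l sum_pinned orbT.
apply: leq_sum => a _.
rewrite exchange_big /=.
under [X in _ <= X]eq_bigr => b _ do rewrite big_distrr /=.
rewrite [X in _ <= X]exchange_big /=; apply: leq_sum => c _.
(* From here [b] holds d at position [i0] and [z] is the former b_0. As d is adjacent to all a_i,
   [X a b] holds. *)
rewrite (sum_update i0); apply: leq_sum => b _.
apply: (@leq_trans (\sum_z X a b * (R a b c * ((codeg E (a i0) c <= Y) * (E (a i0) z * E c z))))).
  apply: leq_sum => z _.
  case: and4P => // -[/and3P [/injectiveP ia /injectiveP ib /forallP hE]].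
  case/andP => /= Ecb /forallP hl /forallP hY hr.
  have updE i : i != i0 -> update i0 b z i = b i by move=> /negbTE h; rewrite ffunE h.
  have upd0 : update i0 b z i0 = z by rewrite ffunE eqxx.
  have nb i : i != i0 -> b i != b i0.
    by move=> h; case/and4P: (hl i) => _ _ _; rewrite updE.
  have XT : X a b.
    apply/andP; split; last by apply/forallP => i; case/and4P: (hl i).
    apply/and3P; split; first exact/injectiveP.
      apply/injectiveP => i j.
      case: (eqVneq i i0) => [->|hi]; case: (eqVneq j i0) => [->|hj] //.
      - by move=> e; have := nb j hj; rewrite e eqxx.
      - by move=> e; have := nb i hi; rewrite e eqxx.
      by move=> e; apply: ib; rewrite !updE.
    apply/forallP => i; case: (eqVneq i i0) => [->|hi].
      by case/and4P: (hl i0).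
    by have := hE i; rewrite updE.
  have RT : R a b c.
    apply/andP; split => //; apply/forallP => i.
    case/and4P: (hl i) => _ h1 -> _; rewrite andbT.
    case: (eqVneq i i0) => [-> //|hi].
    by rewrite updE in h1.
  rewrite XT RT hY; have := hE i0; rewrite upd0 => ->.
  by case/and4P: (hl i0) => _; rewrite upd0 => ->.
rewrite -!big_distrr /= leq_mul2l leq_mul2l -/(codeg E (a i0) c).
by case: (leqP (codeg E (a i0) c) Y) => h; rewrite ?mul0n ?mul1n ?h !orbT.
Qed.

End Light.

Section LightCount.
Variables (A B : finType) (s t : nat) (E : A -> B -> bool) (D Y : nat).
Hypotheses (s0 : 0 < s) (hH : Hfree s t E).
Hypothesis degA : forall x, \sum_z E x z <= D.
Hypothesis degB : forall z, \sum_x E x z <= D.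

Definition light (p q : A * B) :=
  (codeg E p.1 q.1 <= Y) && (codeg (transpose E) p.2 q.2 <= Y).

Definition light_link (a : {ffun 'I_s -> A}) (b : {ffun 'I_s -> B}) (q : A * B) :=
  link E a b q && [forall i, light (a i, b i) q].

(** A vertex c or d lying on more than s + t light links is a rich centre. The links avoiding such
    vertices have degrees at most s + t, so more than 2(s + t)t of them would contain a
    t-matching. *)
Lemma light_links_le (a : {ffun 'I_s -> A}) (b : {ffun 'I_s -> B}) :
  matching E a b ->
  \sum_c \sum_d light_link a b (c, d) <= 2 * (s + t) * t +
    (\sum_c \sum_d [&& link E a b (c, d), [forall i, codeg E (a i) c <= Y]
                     & rich t E a c] +
     \sum_c \sum_d [&& link E a b (c, d),
                       [forall i, codeg (transpose E) (b i) d <= Y]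
                     & rich t (transpose E) b d]).
Proof.
move=> hM; set L := s + t.
pose x c := \sum_d light_link a b (c, d).
pose x' d := \sum_c light_link a b (c, d).
pose S := [set p | [&& light_link a b p, x p.1 <= L & x' p.2 <= L]].
have cS : #|S| <= 2 * L * t.
  rewrite leqNgt; apply/negP => hS.
  have [|||u [su u1 u2 uS]] := @greedy_matching A B L t S _ _ _ (ltnW hS).
  - by rewrite /L addn_gt0 s0.
  - move=> c; case: (leqP (x c) L) => hx.
      by apply: leq_trans hx; apply: leq_sum => d _; rewrite inE; case: (light_link _ _ _); rewrite ?leq_b1.
    by rewrite big1 // => d _; rewrite inE /= leqNgt hx andbF.
  - move=> d; case: (leqP (x' d) L) => hx.
      by apply: leq_trans hx; apply: leq_sum => c _; rewrite inE; case: (light_link _ _ _); rewrite ?leq_b1.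
    by rewrite big1 // => c _; rewrite inE /= [x' d <= L]leqNgt hx !andbF.
  have /negP := hH hM su u1 u2; apply; apply/allP => p /uS.
  by rewrite inE => /and3P [/andP []].
have -> : \sum_c \sum_d light_link a b (c, d) = \sum_p light_link a b p.
  by rewrite sum_prodE.
apply: (@leq_trans (\sum_p ((p \in S) +
   ([&& link E a b p, [forall i, codeg E (a i) p.1 <= Y] & rich t E a p.1] +
    [&& link E a b p, [forall i, codeg (transpose E) (b i) p.2 <= Y]
                     & rich t (transpose E) b p.2])))).
  apply: leq_sum => -[c d] _.
  case: (boolP (light_link _ _ _)) => // /andP [hl /forallP hZ].
  have h1 : [forall i, codeg E (a i) c <= Y].
    by apply/forallP => i; case/andP: (hZ i).
  have h2 : [forall i, codeg (transpose E) (b i) d <= Y].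
    by apply/forallP => i; case/andP: (hZ i).
  rewrite /= hl h1 h2 /=.
  case: (leqP (x c) L) => hx; last first.
    have -> : rich t E a c.
      apply: leq_trans hx _; apply: leq_sum => d' _.
      case: (boolP (light_link _ _ _)) => // /andP [/andP [/= h /forallP h'] _].
      by rewrite h andbT lt0b; apply/forallP => i; case/and4P: (h' i).
    by rewrite addnCA leq_addr.
  case: (leqP (x' d) L) => hx'; last first.
    have -> : rich t (transpose E) b d.
      apply: leq_trans hx' _; apply: leq_sum => c' _.
      case: (boolP (light_link _ _ _)) => // /andP [/andP [/= h /forallP h'] _].
      rewrite {2}/transpose h andbT lt0b; apply/forallP => i.
      by case/and4P: (h' i).
    by rewrite !addnA leq_addl.
  have -> : (c, d) \in S; last exact: leq_addr.
  by rewrite inE /light_link hl hx hx' !andbT /=; apply/forallP.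
rewrite !big_split /=; apply: leq_add; last by rewrite !sum_prodE.
by rewrite -big_mkcond /= sum1_card.
Qed.

Lemma sum_matching_le :
  \sum_(a : {ffun 'I_s -> A}) \sum_b matching E a b <= (\sum_x \sum_z E x z) ^ s.
Proof.
rewrite -(sum_prodE (fun p => E p.1 p.2 : nat)) -(sum_ffun_expn s) sum_ffun_pair.
apply: leq_sum => a _; apply: leq_sum => b _.
case: (boolP (matching E a b)) => // /and3P [_ _ /forallP h].
by rewrite big1 // => i _; rewrite ffunE /= h.
Qed.

Lemma light_count_upper :
  \sum_a \sum_b matching E a b * \sum_c \sum_d light_link a b (c, d) <=
  2 * (s + t) * t * (\sum_x \sum_z E x z) ^ s + t * Y * (#|A| + #|B|) * D ^ (2 * s).-1.
Proof.
pose U (a : {ffun 'I_s -> A}) (b : {ffun 'I_s -> B}) := \sum_c \sum_d [&& matching E a b, link E a b (c, d),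
    [forall i, codeg E (a i) c <= Y] & rich t E a c].
pose V (a : {ffun 'I_s -> A}) (b : {ffun 'I_s -> B}) := \sum_c \sum_d [&& matching E a b, link E a b (c, d),
    [forall i, codeg (transpose E) (b i) d <= Y] & rich t (transpose E) b d].
apply: (@leq_trans (\sum_a \sum_b (matching E a b * (2 * (s + t) * t) + (U a b + V a b)))).
  apply: leq_sum => a _; apply: leq_sum => b _; rewrite /U /V.
  case: (boolP (matching E a b)) => //= hM; rewrite !mul1n.
  exact: light_links_le.
under eq_bigr => a _ do rewrite !big_split /=.
rewrite !big_split /=; apply: leq_add.
  under eq_bigr => a _ do rewrite -big_distrl /=.
  by rewrite -big_distrl /= mulnC leq_mul2l sum_matching_le orbT.
rewrite addnC (mulnDr (t * Y)) mulnDl; apply: leq_add; last first.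
  exact: sum_rich_stars.
rewrite exchange_big /=.
apply: leq_trans (sum_rich_stars Y s0 (Hfree_transpose hH) degB degA).
apply: leq_sum => b _; apply: leq_sum => a _; rewrite /V exchange_big /=.
apply: leq_sum => d _; apply: leq_sum => c _.
by rewrite matching_transpose link_transpose.
Qed.

(** Convexity over the edges cd, each contributing the bound of [matchings_lower] with loss s^2 (D +
    D). *)
Lemma light_count_lower :
  (\sum_c \sum_d E c d *
      (\sum_p [&& E p.1 p.2, E p.1 d, E c p.2 & light p (c, d)])
     - 2 * s ^ 2 * D * \sum_x \sum_z E x z) ^ s <=
  (\sum_x \sum_z E x z) ^ s.-1 *
  \sum_a \sum_b matching E a b * \sum_c \sum_d light_link a b (c, d).
Proof.
pose m (q : A * B) := \sum_p [&& E p.1 p.2, E p.1 q.2, E q.1 p.2 & light p q].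
pose q0 := 2 * s ^ 2 * D.
have -> : \sum_x \sum_z E x z = \sum_q E q.1 q.2 by rewrite sum_prodE.
apply: (@leq_trans ((\sum_q E q.1 q.2 * (m q - q0)) ^ s)).
  apply: leq_wexp2r; rewrite leq_subLR mulnC big_distrl -big_split sum_prodE /=.
  apply: leq_sum => c _; apply: leq_sum => d _; rewrite -mulnDr leq_mul2l.
  by rewrite -/(m (c, d)) -leq_subLR leqnn orbT.
have := @power_mean _ (fun q => E q.1 q.2) (fun q => m q - q0) s.-1.
rewrite prednK // => h; apply: (leq_trans h); rewrite leq_mul2l; apply/orP; right.
apply: (@leq_trans (\sum_q E q.1 q.2 * \sum_(a : {ffun 'I_s -> A}) \sum_(b : {ffun 'I_s -> B})
   [&& matching E a b, link E a b q & [forall i, light (a i, b i) q]])).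
  apply: leq_sum => -[c d] _ /=; case: (boolP (E c d)) => // Ecd; rewrite !mul1n.
  have -> : q0 = s ^ 2 * (D + D) by rewrite /q0; lia.
  apply: (@matchings_lower A B s E (fun p => light p (c, d)) c d D D Ecd).
    by move=> x; apply: leq_trans (degA x); apply: leq_sum => z _; case: (E x z); rewrite ?leq_b1.
  by move=> z; apply: leq_trans (degB z); apply: leq_sum => x _; case: (E x z); rewrite ?leq_b1.
under eq_bigr => q _.
  rewrite big_distrr /=; under eq_bigr => a _ do rewrite big_distrr /=.
  over.
rewrite exchange_big /=; apply: leq_sum => a _.
rewrite exchange_big /=; apply: leq_sum => b _.
rewrite sum_prodE big_distrr /=; apply: leq_sum => c _.
rewrite big_distrr /=; apply: leq_sum => d _; rewrite /light_link.
by case: (E c d); rewrite //= mul1n mulnb.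
Qed.

End LightCount.

(** * Pairs of large codegree *)

(** Dyadic decomposition: the layer from Y to 2Y contributes at most 4M / Y, and induction at 2Y
    bounds the rest by 4M / Y. The number k of scales makes the induction end. *)
Lemma level_sets_sum (A : finType) (y : A -> nat) (M Y k : nat) : 0 < Y ->
  (forall v, Y <= v -> #|[set x | v <= y x]| * v ^ 3 <= M) ->
  (forall x, y x < Y * 2 ^ k) ->
  Y * \sum_(x | Y <= y x) y x ^ 2 <= 8 * M.
Proof.
elim: k Y => [|k IH] Y Y0 hM hk.
  rewrite big1 ?muln0 // => x; rewrite leqNgt.
  by have := hk x; rewrite muln1 => ->.
have h2 : 2 * Y * \sum_(x | 2 * Y <= y x) y x ^ 2 <= 8 * M.
  apply: IH; first by lia.
    by move=> v hv; apply: hM; lia.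
  by move=> x; rewrite mulnAC mulnC mulnA mulnAC -mulnA -expnSr; apply: hk.
have h1 : \sum_(x | (Y <= y x) && (y x < 2 * Y)) y x ^ 2 <=
    #|[set x | Y <= y x]| * (2 * Y) ^ 2.
  rewrite -sum_nat_cond_const big_mkcond [X in _ <= X]big_mkcond /=.
  apply: leq_sum => x _; case: (Y <= y x) => //=; case: ltnP => // h.
  by rewrite leq_wexp2r // ltnW.
have hs : \sum_(x | Y <= y x) y x ^ 2 =
    \sum_(x | (Y <= y x) && (y x < 2 * Y)) y x ^ 2 + \sum_(x | 2 * Y <= y x) y x ^ 2.
  rewrite (bigID (fun x => y x < 2 * Y)) /=; congr (_ + _).
  by apply: eq_bigl => x; lia.
rewrite hs; have := hM Y (leqnn _); move: h1 h2; rewrite !expnS expn0 !muln1.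
move: #|_| (\sum_(_ | _ && _) _) (\sum_(x | 2 * Y <= y x) _); clear; nia.
Qed.

Section Heavy.
Variables (A B : finType) (s t : nat) (E : A -> B -> bool) (D Y : nat).
Hypotheses (s2 : 1 < s) (hH : Hfree s t E) (Y0 : 0 < Y).
Hypothesis degA : forall x, \sum_z E x z <= D.
Hypothesis hY : Kdense s t * D ^ s <= Y ^ s.+1.

Lemma Hfree_sub (E' : A -> B -> bool) :
  (forall x z, E' x z -> E x z) -> Hfree s t E'.
Proof.
move=> hE a b u /and3P [ia ib /forallP h] su u1 u2.
apply/negP => /allP hu.
have hM : matching E a b.
  by rewrite /matching ia ib; apply/forallP => i; apply: hE.
have /negP := hH hM su u1 u2; apply.
apply/allP => p /hu /andP [h1 /forallP h2]; apply/andP; split; first exact: hE.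
by apply/forallP => i; case/and4P: (h2 i) => /hE -> /hE -> -> ->.
Qed.

(** The dense bound applies between these x and the neighbourhood of c. Each x keeps exactly v of
    its common neighbours with c, since that bound asks for equal degrees. *)
Lemma heavy_level (c : A) (v : nat) : Y <= v ->
  #|[set x | v <= codeg E x c]| * v ^ s.+1 <= Kdense s t * D ^ s.+1.
Proof.
move=> hv.
pose N x := [set z | E x z && E c z].
have cN x : #|N x| = codeg E x c.
  by rewrite -sum1dep_card big_mkcond; apply: eq_bigr => z _; rewrite mulnb; case: (_ && _).
pose Tr x := [set z in take v (enum (N x))].
pose F := [set x | v <= codeg E x c].
pose E' x z := (x \in F) && (z \in Tr x).
have TrN x z : z \in Tr x -> z \in N x.
  by rewrite inE => /mem_take; rewrite mem_enum.
apply: (@uniform_dense_bound A B s t v D E' F [set z | E c z]).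
- exact: ltnW.
- exact: leq_trans hv.
- by apply: Hfree_sub => x z /andP [_ /TrN]; rewrite inE => /andP [].
- move=> x xF; rewrite /E' xF /= -big_mkcond /= sum1_card /Tr cardsE.
  rewrite (card_uniqP _) ?take_uniq ?enum_uniq // size_takel // -cardE cN.
  by rewrite inE in xF.
- by move=> x z /andP [-> /TrN]; rewrite !inE => /andP [].
- apply: leq_trans (degA c); rewrite -sum1dep_card big_mkcond.
  by apply: leq_sum => z _; case: (E c z).
- by apply: leq_trans hY _; apply: leq_wexp2r.
Qed.

(** For v >= Y, v^(s+1) >= v^3 Y^(s-2), so [heavy_level] gives the cubic decay that [level_sets_sum]
    asks for. *)
Lemma heavy_count :
  Y ^ s.-1 * \sum_c \sum_x (Y <= codeg E x c) * codeg E x c ^ 2 <=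
  #|A| * (8 * (Kdense s t * D ^ s.+1)).
Proof.
rewrite -sum_nat_const big_distrr /=; apply: leq_sum => c _.
have -> : \sum_x (Y <= codeg E x c) * codeg E x c ^ 2 =
    \sum_(x | Y <= codeg E x c) codeg E x c ^ 2.
  by rewrite [RHS]big_mkcond; apply: eq_bigr => x _; case: ifP; rewrite ?mul1n.
have Yp : 0 < Y ^ s.-2 by rewrite expn_gt0 Y0.
set M := Kdense s t * D ^ s.+1.
have h : Y * \sum_(x | Y <= codeg E x c) codeg E x c ^ 2 <= 8 * (M %/ Y ^ s.-2).
  apply: (@level_sets_sum _ _ _ _ D.+1) => //.
    move=> v hv; rewrite leq_divRL //; apply: leq_trans (heavy_level c hv).
    have -> : s.+1 = 3 + s.-2 by lia.
    by rewrite expnD mulnA leq_mul2l leq_wexp2r ?orbT.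
  move=> x; apply: (@leq_ltn_trans D).
    apply: leq_trans (degA x); apply: leq_sum => z _.
    by case: (E x z); rewrite ?mul0n ?mul1n ?leq_b1.
  apply: leq_trans (ltn_expl D (isT : 1 < 2)) _.
  rewrite expnS mulnA leq_pmull // muln_gt0 Y0 //.
have -> : Y ^ s.-1 = Y ^ s.-2 * Y by rewrite -expnSr; congr (_ ^ _); lia.
rewrite -mulnA.
apply: leq_trans (leq_mul (leqnn _) h) _.
by rewrite mulnCA leq_mul2l mulnC leq_divM orbT.
Qed.

End Heavy.

(** * The bipartite bound *)

Lemma cauchy_sum (I : finType) (g : I -> nat) :
  (\sum_i g i) ^ 2 <= #|I| * \sum_i g i ^ 2.
Proof.
have e k : \sum_i 1 * g i ^ k = \sum_i g i ^ k.
  by apply: eq_bigr => i _; rewrite mul1n.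
have := power_mean (fun=> 1) g 1; rewrite sum1_card expn1 e.
by under eq_bigr => i _ do rewrite mul1n.
Qed.

Section FourCycles.
Variables (A B : finType) (E : A -> B -> bool).

(** The squared codegrees count closed 4-walks, degenerate ones included; Cauchy-Schwarz is used
    twice. *)
Lemma sum_codeg_sq_lower :
  (\sum_x \sum_z E x z) ^ 4 <= (#|A| * #|B|) ^ 2 * \sum_c \sum_x codeg E x c ^ 2.
Proof.
set e := \sum_x _.
have h1 : e ^ 2 <= #|B| * \sum_z (\sum_x E x z) ^ 2.
  by rewrite /e exchange_big; apply: cauchy_sum.
have h2 : (\sum_c \sum_x codeg E x c) ^ 2 <=
    #|A| ^ 2 * \sum_c \sum_x codeg E x c ^ 2.
  have := cauchy_sum (fun p : A * A => codeg E p.2 p.1).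
  by rewrite card_prod mulnn !sum_prodE.
have h3 : \sum_c \sum_x codeg E x c = \sum_z (\sum_x E x z) ^ 2.
  under [RHS]eq_bigr => z _ do rewrite -mulnn big_distrlr /=.
  rewrite [RHS]exchange_big /=; apply: eq_bigr => c _.
  rewrite [RHS]exchange_big /=; apply: eq_bigr => x _.
  by apply: eq_bigr => z _; rewrite mulnC.
rewrite h3 in h2.
rewrite -[4]/(2 * 2) expnM; apply: leq_trans (leq_wexp2r 2 h1) _.
by rewrite expnMn (expnMn #|A|) -[X in _ <= X]mulnA [X in _ <= X]mulnCA leq_mul2l h2 orbT.
Qed.

(** A closed 4-walk that is not light has codegree above Y on one of its diagonals, (c, x) or (d,
    z). *)
Lemma four_cycles_split (Y : nat) :
  \sum_c \sum_x codeg E x c ^ 2 <=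
  \sum_c \sum_d E c d *
      (\sum_p [&& E p.1 p.2, E p.1 d, E c p.2 & light E Y p (c, d)]) +
  (\sum_c \sum_x (Y < codeg E x c) * codeg E x c ^ 2 +
   \sum_d \sum_z (Y < codeg (transpose E) z d) * codeg (transpose E) z d ^ 2).
Proof.
have sqE (A' B' : finType) (F : A' -> B' -> bool) (w : A' -> A' -> nat) :
    \sum_c \sum_x w c x * codeg F x c ^ 2 =
    \sum_c \sum_x \sum_d \sum_z w c x * (F x d * F c d * (F x z * F c z)).
  apply: eq_bigr => c _; apply: eq_bigr => x _.
  rewrite -mulnn /codeg big_distrlr /= big_distrr /=; apply: eq_bigr => d _.
  by rewrite big_distrr.
have -> : \sum_c \sum_x codeg E x c ^ 2 = \sum_c \sum_x 1 * codeg E x c ^ 2.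
  by apply: eq_bigr => c _; apply: eq_bigr => x _; rewrite mul1n.
rewrite !sqE.
have -> : \sum_d \sum_z \sum_c \sum_x (Y < codeg (transpose E) z d) *
   (transpose E z c * transpose E d c * (transpose E z x * transpose E d x)) =
   \sum_c \sum_x \sum_d \sum_z (Y < codeg (transpose E) z d) *
   (E x d * E c d * (E x z * E c z)).
  under eq_bigr => d _ do rewrite exchange_big /=.
  under eq_bigr => d _ do under eq_bigr => c _ do rewrite exchange_big /=.
  rewrite exchange_big /=; apply: eq_bigr => c _; rewrite exchange_big /=.
  apply: eq_bigr => x _; apply: eq_bigr => d _; apply: eq_bigr => z _.
  by rewrite /transpose; case: (E c z); case: (E c d); case: (E x z); case: (E x d).
have -> : \sum_c \sum_d E c d *
      (\sum_p [&& E p.1 p.2, E p.1 d, E c p.2 & light E Y p (c, d)]) =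
   \sum_c \sum_x \sum_d \sum_z light E Y (x, z) (c, d) * (E x d * E c d * (E x z * E c z)).
  apply: eq_bigr => c _.
  under eq_bigr => d _ do rewrite sum_prodE big_distrr /=.
  rewrite exchange_big /=; apply: eq_bigr => x _; apply: eq_bigr => d _.
  rewrite big_distrr; apply: eq_bigr => z _ /=.
  by case: (E c z); case: (E c d); case: (E x z); case: (E x d); case: (light _ _ _ _).
rewrite -!big_split; apply: leq_sum => c _; rewrite -!big_split; apply: leq_sum => x _.
rewrite -!big_split; apply: leq_sum => d _; rewrite -!big_split; apply: leq_sum => z _ /=.
rewrite -!mulnDl leq_mul2r; apply/orP; right.
by rewrite /light /=; case: (leqP (codeg E x c)); case: (leqP (codeg (transpose E) z d)).
Qed.

End FourCycles.

(** The last hypothesis puts e above a constant times n^(4s/(2s+1)), so only be/al <= 4s/(2s+1) and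
    the constants need checking. *)
Lemma exponent_trade (s e n C c al be : nat) :
  0 < n -> 0 < al -> be * (2 * s).+1 <= al * (4 * s) -> c ^ (2 * s).+1 <= C ->
  C * n ^ (4 * s) < e ^ (2 * s).+1 -> c * n ^ be <= e ^ al.
Proof.
move=> n0 al0 hab hc he.
rewrite -(@leq_exp2r _ _ (2 * s).+1) // expnMn -expnM -(expnM e) (mulnC al) (expnM e).
apply: leq_trans (leq_wexp2r al (ltnW he)).
rewrite expnMn -expnM; apply: leq_mul; last first.
  by rewrite leq_pexp2l // [4 * s * al]mulnC.
apply: leq_trans hc _; case: C {he} => // C.
by rewrite -{1}(expn1 C.+1) leq_pexp2l.
Qed.

Section Core.
Variables (s t K : nat).
Hypothesis s2 : 1 < s.

(** The summand 1 makes it a legitimate divisor. *)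
Definition Clight := 4 ^ s.+1 * t * K ^ (2 * s).-1 + 1.

(** The summands serve, in order, the bounded part of the light links ([T1]), the loss in
    [light_count_lower] ([hR]), the hypothesis of [heavy_count] ([hY]), and the final
    contradiction. *)
Definition Ccore :=
  4 ^ s.+1 * (s + t) * t + (8 * s ^ 2 * K) ^ (2 * s).+1 +
  (Kdense s t * K ^ s * Clight ^ s.+1) ^ (2 * s).+1 +
  (32 * Kdense s t * Clight ^ s.-1 * K ^ s.+1 + 1) ^ (2 * s).+1.

Lemma bipartite_bound (A B : finType) (E : A -> B -> bool) (D n : nat) :
  #|A| <= n -> #|B| <= n ->
  (forall x, \sum_z E x z <= D) -> (forall z, \sum_x E x z <= D) ->
  D * n <= K * \sum_x \sum_z E x z -> Hfree s t E ->
  (\sum_x \sum_z E x z) ^ (2 * s).+1 <= Ccore * n ^ (4 * s).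
Proof.
move=> cA cB degA degB; set e := \sum_x _ => hD hH.
rewrite leqNgt; apply/negP => he.
have n0 : 0 < n.
  case: (posnP n) => // n0; move: he; rewrite /e big1 ?exp0n //= => x _.
  by exfalso; move: (fintype0 x); move: cA; rewrite n0 leqn0 => /eqP ->; apply.
have e0 : 0 < e by case: (posnP e) he => // ->; rewrite exp0n.
set Q := \sum_c \sum_x codeg E x c ^ 2.
have s0 : 0 < s by exact: ltnW.
have hQ : e ^ 4 <= n ^ 4 * Q.
  apply: leq_trans (sum_codeg_sq_lower E) _; rewrite leq_mul2r; apply/orP; right.
  by rewrite -[4]/(2 * 2) expnM leq_wexp2r // -mulnn leq_mul.
(* Up to constants, the largest threshold keeping the rich stars ([T2]) below half of
   [e ^ (3 * s).+1] when D is about K e / n. *)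
pose Y := e ^ s.+2 %/ (Clight * n ^ (2 * s).+2).
have C2 : 0 < Clight by rewrite /Clight addn1.
have hY1 : Clight * n ^ (2 * s).+2 * Y <= e ^ s.+2 by rewrite mulnC leq_divM.
have hY2 : e ^ s.+2 <= Clight * n ^ (2 * s).+2 * Y.+1.
  by rewrite mulnC ltnW // ltn_ceil // muln_gt0 C2 expn_gt0 n0.
pose Ql := \sum_c \sum_d E c d *
      (\sum_p [&& E p.1 p.2, E p.1 d, E c p.2 & light E Y p (c, d)]).
have hDp k : D ^ k * n ^ k <= K ^ k * e ^ k by rewrite -!expnMn leq_wexp2r.
(* Either at least half of the closed 4-walks are light, or more than half have a diagonal of large
   codegree. *)
case: (leqP Q (2 * Ql)) => hl.
- pose R := Ql - 2 * s ^ 2 * D * e.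
  have hR : Q <= 4 * R.
    have : 8 * s ^ 2 * D * e <= Q.
      have key : 8 * s ^ 2 * K * n ^ 3 <= e ^ 2.
        apply: (@exponent_trade s e n Ccore) => //; first by move: s2; clear; lia.
        by rewrite /Ccore -!addnA addnCA leq_addr.
      rewrite -(@leq_pmul2l (n ^ 4)) ?expn_gt0 ?n0 //; apply: leq_trans hQ.
      have a1 := leq_mul (leqnn (8 * s ^ 2 * n ^ 3 * e)) hD.
      have a2 := leq_mul key (leqnn (e ^ 2)).
      have -> : e ^ 4 = e ^ 2 * e ^ 2 by rewrite -expnD.
      apply: leq_trans a2; rewrite -[X in _ <= _ * X]mulnn (expnS n 3).
      by move: a1; move: (s ^ 2) (n ^ 3); clear; lia.
    rewrite /R; move: hl; clear; lia.
  have h1 : R ^ s <= e ^ s.-1 * (2 * (s + t) * t * e ^ s + t * Y * (n + n) * D ^ (2 * s).-1).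
    apply: leq_trans (light_count_lower Y s0 degA degB) _.
    rewrite leq_mul2l; apply/orP; right.
    apply: leq_trans (light_count_upper Y s0 hH degA degB) _.
    by rewrite leq_add2l leq_mul2r leq_mul2l leq_add ?orbT.
  have h2 : e ^ (4 * s) <= n ^ (4 * s) * (4 ^ s * R ^ s).
    by rewrite !(expnM _ 4) -!expnMn leq_wexp2r // (leq_trans hQ) // leq_mul2l hR orbT.
  have h3 : e ^ (3 * s).+1 <= n ^ (4 * s) * 4 ^ s *
       (2 * (s + t) * t * e ^ s + t * Y * (n + n) * D ^ (2 * s).-1).
    have ee : e ^ (4 * s) = e ^ s.-1 * e ^ (3 * s).+1.
      by rewrite -expnD; congr (_ ^ _); move: s0; clear; lia.
    have ep : 0 < e ^ s.-1 by rewrite expn_gt0 e0.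
    rewrite -(leq_pmul2l ep) -ee; apply: (leq_trans h2).
    by rewrite mulnA [X in _ <= X]mulnCA leq_mul2l h1 orbT.
  have T1 : 2 * (n ^ (4 * s) * 4 ^ s * (2 * (s + t) * t * e ^ s)) < e ^ (3 * s).+1.
    have -> : e ^ (3 * s).+1 = e ^ s * e ^ (2 * s).+1.
      by rewrite -expnD; congr (_ ^ _); move: s0; clear; lia.
    have ep : 0 < e ^ s by rewrite expn_gt0 e0.
    apply: (@leq_ltn_trans (e ^ s * (Ccore * n ^ (4 * s)))); last by rewrite ltn_pmul2l.
    apply: (@leq_trans (e ^ s * (4 ^ s.+1 * (s + t) * t * n ^ (4 * s)))).
      by rewrite expnS; move: (4 ^ s) (e ^ s) (n ^ (4 * s)); clear; lia.
    by rewrite !leq_mul2l leq_mul2r /Ccore -!addnA leq_addr !orbT.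
  have T2 : 2 * (n ^ (4 * s) * 4 ^ s * (t * Y * (n + n) * D ^ (2 * s).-1)) <= e ^ (3 * s).+1.
    set k := (2 * s).-1.
    have np : 0 < n ^ k by rewrite expn_gt0 n0.
    rewrite -(leq_pmul2r np).
    have a1 := leq_mul (leqnn (4 ^ s.+1 * t * Y * n ^ (4 * s).+1)) (hDp k).
    apply: (@leq_trans (4 ^ s.+1 * t * Y * n ^ (4 * s).+1 * (D ^ k * n ^ k))).
      by rewrite (expnS 4) (expnS n); move: (4 ^ s) (D ^ k) (n ^ k) (n ^ (4 * s)); clear; lia.
    apply: (leq_trans a1).
    have -> : n ^ (4 * s).+1 = n ^ (2 * s).+2 * n ^ k.
      by rewrite -expnD; congr (_ ^ _); rewrite /k; move: s0; clear; lia.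
    have -> : e ^ (3 * s).+1 = e ^ s.+2 * e ^ k.
      by rewrite -expnD; congr (_ ^ _); rewrite /k; move: s0; clear; lia.
    have a2 := leq_mul hY1 (leqnn (n ^ k * e ^ k)).
    apply: leq_trans (_ : _ <= e ^ s.+2 * (n ^ k * e ^ k)) _; last by rewrite [n ^ k * _]mulnC mulnA.
    apply: leq_trans a2; rewrite /Clight -/k mulnDl.
    by move: (4 ^ s.+1) (K ^ k) (n ^ (2 * s).+2) (n ^ k) (e ^ k); clear; lia.
  by move: h3 T1 T2; rewrite mulnDr; clear; lia.
have hY : Kdense s t * D ^ s <= Y.+1 ^ s.+1.
  (* The exponent condition (2s^2 + 3s + 2)(2s + 1) <= 4s (s^2 + 2s + 2) amounts to s >= 2. *)
  have key : Kdense s t * K ^ s * Clight ^ s.+1 * n ^ (2 * (s * s) + 3 * s + 2) <=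
      e ^ (s * s + 2 * s + 2).
    apply: (@exponent_trade s e n Ccore) => //; first by move: s2; clear; lia.
      by move: s2; clear; nia.
    by rewrite /Ccore -!addnA addnA addnCA leq_addr.
  have p1 : 0 < n ^ s * (Clight * n ^ (2 * s).+2) ^ s.+1.
    by rewrite muln_gt0 !expn_gt0 muln_gt0 expn_gt0 n0 C2.
  rewrite -(leq_pmul2l p1).
  have a1 := leq_mul (leqnn (n ^ s)) (leq_wexp2r s.+1 hY2).
  rewrite [X in _ <= _ * X]expnMn mulnA in a1; apply: leq_trans a1.
  have a2 := leq_mul key (leqnn (e ^ s * n ^ s)).
  have -> : n ^ s * (e ^ s.+2) ^ s.+1 = e ^ (s * s + 2 * s + 2) * (e ^ s * n ^ s).
    rewrite mulnC mulnA -expnM -expnD; congr (_ ^ _ * _); clear; lia.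
  apply: leq_trans a2.
  have -> : (Clight * n ^ (2 * s).+2) ^ s.+1 =
      Clight ^ s.+1 * (n ^ (2 * (s * s) + 3 * s + 2) * n ^ s).
    by rewrite expnMn -expnM -expnD; congr (_ * _ ^ _); clear; lia.
  have a3 := leq_mul (leqnn (Kdense s t * Clight ^ s.+1 *
     (n ^ (2 * (s * s) + 3 * s + 2) * n ^ s))) (hDp s).
  by move: a3; move: (n ^ _) (n ^ s) (D ^ s) (K ^ s) (e ^ s) (Clight ^ s.+1) (Kdense s t); clear; lia.
have hA := heavy_count s2 hH (ltn0Sn Y) degA hY.
have hB := heavy_count s2 (Hfree_transpose hH) (ltn0Sn Y) degB hY.
have hQ2 : Y.+1 ^ s.-1 * Q <= 32 * Kdense s t * (n * D ^ s.+1).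
  have h0 := four_cycles_split E Y; rewrite -/Q -/Ql in h0.
  set QA := \sum_c \sum_x (Y < _) * _ in h0.
  set QB := \sum_d \sum_z (Y < _) * _ in h0.
  have {h0} hQQ : Q <= 2 * (QA + QB) by move: h0 hl; clear; lia.
  apply: leq_trans (leq_mul (leqnn _) hQQ) _.
  have {}hA : Y.+1 ^ s.-1 * QA <= n * (8 * (Kdense s t * D ^ s.+1)).
    by apply: leq_trans hA _; rewrite leq_mul2r cA orbT.
  have {}hB : Y.+1 ^ s.-1 * QB <= n * (8 * (Kdense s t * D ^ s.+1)).
    by apply: leq_trans hB _; rewrite leq_mul2r cB orbT.
  move: hA hB; clear hQQ; move: QA QB (Y.+1 ^ s.-1) (D ^ s.+1) (Kdense s t); clear; lia.
(* Times e^(s+1) n^s, the left side is (e^(s+2))^(s-1) e^4 n^s; [hY2] and [hQ] trade these powers of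
   e for Y + 1 and Q, and [hQ2] applies. *)
have : e ^ (s * s).+1 <= 32 * Kdense s t * Clight ^ s.-1 * K ^ s.+1 * n ^ (2 * (s * s) - s + 2).
  have p1 : 0 < e ^ s.+1 * n ^ s by rewrite muln_gt0 !expn_gt0 e0 n0.
  rewrite -(leq_pmul2r p1).
  have [r hr] : exists r, s = r.+1 by exists s.-1; rewrite prednK.
  have -> : e ^ (s * s).+1 * (e ^ s.+1 * n ^ s) = (e ^ s.+2) ^ s.-1 * e ^ 4 * n ^ s.
    by rewrite mulnA -expnD -expnM -expnD; congr (_ ^ _ * _); rewrite hr /=; clear; lia.
  have a1 := leq_mul (leq_mul (leq_wexp2r s.-1 hY2) hQ) (leqnn (n ^ s)).
  apply: (leq_trans a1).
  rewrite [(Clight * _ * _) ^ _]expnMn.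
  have a2 := leq_mul (leqnn ((Clight * n ^ (2 * s).+2) ^ s.-1 * n ^ 4 * n ^ s)) hQ2.
  have a3 := leq_mul (leqnn ((Clight * n ^ (2 * s).+2) ^ s.-1 * n ^ 4 *
     (32 * Kdense s t))) (hDp s.+1).
  have e1 : (Clight * n ^ (2 * s).+2) ^ s.-1 * n ^ 4 =
     Clight ^ s.-1 * (n ^ (2 * (s * s) - s + 2) * n ^ s).
    rewrite expnMn -expnM -mulnA -!expnD; congr (_ * _ ^ _); rewrite hr /=.
    by clear; nia.
  apply: (@leq_trans ((Clight * n ^ (2 * s).+2) ^ s.-1 * n ^ 4 * n ^ s * (Y.+1 ^ s.-1 * Q))).
    by move: (_ ^ s.-1) (Y.+1 ^ s.-1) (n ^ s) (n ^ 4); clear; lia.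
  apply: (leq_trans a2).
  apply: leq_trans (_ : _ <= (Clight * n ^ (2 * s).+2) ^ s.-1 * n ^ 4 *
     (32 * Kdense s t) * (D ^ s.+1 * n ^ s.+1)) _.
    by rewrite (expnS n s); move: (_ ^ s.-1) (n ^ s) (n ^ 4) (D ^ s.+1) (Kdense s t); clear; lia.
  apply: (leq_trans a3); rewrite e1.
  by move: (n ^ _) (n ^ s) (Clight ^ _) (Kdense s t) (K ^ _) (e ^ _); clear; lia.
apply/negP; rewrite -ltnNge.
(* The exponent condition again amounts to s >= 2; the added 1 makes the contradiction strict. *)
have key : (32 * Kdense s t * Clight ^ s.-1 * K ^ s.+1 + 1) * n ^ (2 * (s * s) - s + 2) <=
    e ^ (s * s).+1.
  apply: (@exponent_trade s e n Ccore) => //; first by move: s2; clear; nia.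
  by rewrite /Ccore leq_addl.
apply: leq_trans key; rewrite mulnDl mul1n -[X in X < _]addn0 ltn_add2l.
by rewrite expn_gt0 n0.
Qed.
End Core.

(** * Reduction to bipartite graphs of bounded degree *)

Lemma Hfree_comp (A B A' B' : finType) (s t : nat) (E : A -> B -> bool)
    (f : A' -> A) (g : B' -> B) : injective f -> injective g ->
  Hfree s t E -> Hfree s t (fun x z => E (f x) (g z)).
Proof.
move=> fI gI hH a b u /and3P [/injectiveP ia /injectiveP ib /forallP hE] su u1 u2.
pose a' := [ffun i => f (a i)]; pose b' := [ffun i => g (b i)].
pose u' := [seq (f p.1, g p.2) | p <- u].
have hM : matching E a' b'.
  apply/and3P; split; last by apply/forallP => i; rewrite !ffunE.
    by apply/injectiveP => i j; rewrite !ffunE => /fI /ia.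
  by apply/injectiveP => i j; rewrite !ffunE => /gI /ib.
have := hH a' b' u' hM; rewrite size_map => /(_ su).
have -> : unzip1 u' = map f (unzip1 u) by rewrite /unzip1 -!map_comp.
have -> : unzip2 u' = map g (unzip2 u) by rewrite /unzip2 -!map_comp.
rewrite (map_inj_uniq fI) (map_inj_uniq gI) => /(_ u1 u2).
apply: contra => /allP hu; apply/allP => p /mapP [q /hu /andP [h1 /forallP h2] ->].
apply/andP; split => //; apply/forallP => i; rewrite !ffunE /= !inj_eq //.
Qed.

(** Averaging over all 2-colourings: an ordered edge leaves Z in a quarter of them. *)
Lemma large_cut (V : finType) (E : rel V) : irreflexive E ->
  exists Z : {set V}, \sum_u \sum_v E u v <=
    4 * \sum_u \sum_v [&& E u v, u \in Z & v \notin Z].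
Proof.
move=> irr; set e := \sum_u _.
pose cut (f : {ffun V -> bool}) := \sum_u \sum_v E u v * (f u * ~~ f v).
have pairE u v : E u v ->
    4 * \sum_(f : {ffun V -> bool}) f u * ~~ f v = \sum_(f : {ffun V -> bool}) 1.
  move=> Euv; have nuv : v != u by apply: contraTneq Euv => ->; rewrite irr.
  (* Writes the condition on u and v as a product over all vertices, so that the sum over colourings
     factorises. *)
  pose F w (x : bool) : nat := if w == u then x else if w == v then ~~ x else true.
  have -> : \sum_(f : {ffun V -> bool}) f u * ~~ f v =
      \sum_(f : {ffun V -> bool}) \prod_w F w (f w).
    apply: eq_bigr => f _; rewrite (bigD1 u) //= (bigD1 v) //= big1 ?muln1.
      by rewrite /F !eqxx (negbTE nuv).
    by move=> w /andP [/negbTE h1 /negbTE h2]; rewrite /F h1 h2.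
  have -> : \sum_(f : {ffun V -> bool}) 1 =
      \sum_(f : {ffun V -> bool}) \prod_(w : V) 1 by apply: eq_bigr => f _; rewrite big1.
  rewrite sum_ffun_prod (sum_ffun_prod (fun _ _ => 1)).
  rewrite (bigD1 u) //= (bigD1 v) //= [RHS](bigD1 u) //= [in RHS](bigD1 v) //=.
  rewrite !big_bool /= /F !eqxx (negbTE nuv) /= !mul1n mulnA; congr (_ * _).
  apply: eq_bigr => w /andP [/negbTE h1 /negbTE h2].
  by rewrite !big_bool h1 h2.
have tot : \sum_f 4 * cut f = e * \sum_(f : {ffun V -> bool}) 1.
  rewrite -big_distrr /cut exchange_big /e big_distrl big_distrr /=; apply: eq_bigr => u _.
  rewrite exchange_big big_distrl big_distrr /=; apply: eq_bigr => v _.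
  rewrite -big_distrr /= mulnCA; case: (boolP (E u v)) => // /pairE ->.
  by [].
have [f hf] : exists f, e <= 4 * cut f.
  apply/existsP; apply: contraT; rewrite negb_exists => /forallP h.
  have : \sum_f (4 * cut f + 1) <= \sum_(f : {ffun V -> bool}) e.
    by apply: leq_sum => f _; rewrite addn1 ltnNge h.
  rewrite big_split /= tot big_distrr /= muln1 -[X in _ <= X]addn0 leq_add2l.
  by rewrite sum1_card leqn0 card_ffun card_bool expn_eq0.
exists [set w | f w]; apply: leq_trans hf _; rewrite leq_mul2l /=.
apply: leq_sum => u _; apply: leq_sum => v _; rewrite !inE.
by case: (E u v); case: (f u); case: (f v).
Qed.

(** Deleting an element with the smallest value of phi never lowers the average. *)
Lemma large_average_subset (V : finType) (phi : V -> nat) (X : {set V}) (h : nat) :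
  h <= #|X| -> exists P : {set V}, [/\ P \subset X, #|P| = h &
    h * \sum_(v in X) phi v <= #|X| * \sum_(v in P) phi v].
Proof.
move: {2}(#|X| - h) (erefl (#|X| - h)) => k; elim: k X => [|k IH] X hk hX.
  by exists X; split => //; [lia | have -> : #|X| = h by lia].
have [x0 x0X] : exists x, x \in X by apply/card_gt0P; lia.
pose x := [arg min_(x < x0 in X) phi x].
have [xX xmin] : x \in X /\ forall y, y \in X -> phi x <= phi y.
  by rewrite /x; case: arg_minnP.
pose X1 := X :\ x.
have cX : #|X| = #|X1|.+1 by rewrite (cardsD1 x) xX.
have sX : \sum_(v in X) phi v = phi x + \sum_(v in X1) phi v by rewrite (big_setD1 x).
have hx : #|X1| * phi x <= \sum_(v in X1) phi v.
  by rewrite -sum_nat_const; apply: leq_sum => y; rewrite inE => /andP [_ /xmin].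
have [||P [sP cP hP]] := IH X1; [lia | lia |].
exists P; split => //; first exact: subset_trans sP (subD1set _ _).
case: (posnP #|X1|) => c1; first by have -> : h = 0 by lia.
rewrite -(leq_pmul2l c1) sX cX.
move: hx hP; move: (\sum_(v in X1) _) (\sum_(v in P) _) #|X1| (phi x); clear; nia.
Qed.

Lemma sum_setXE (V : finType) (E : rel V) (P Q : {set V}) :
  \sum_(u in P) \sum_(v in Q) E u v = \sum_u \sum_v [&& E u v, u \in P & v \in Q].
Proof.
rewrite big_mkcond; apply: eq_bigr => u _; case: (boolP (u \in P)) => uP /=.
  rewrite big_mkcond; apply: eq_bigr => v _.
  by case: (E u v); case: (v \in Q).
by rewrite big1 // => v _; rewrite andbF.
Qed.

(** The first summand pays for passing to a cut with an eighth of the ordered edges; the second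
    forces a violating set to have at least 256 vertices. *)
Definition Cgraph (s t : nat) := 8 ^ (2 * s).+1 * Ccore s t 2048 + 256 ^ 2.

(* In a vertex set [X] of minimal size among those violating the bound, the
   vertices of degree above 256 times the average meet few edges: otherwise
   they span, together with N/256 further vertices, a smaller violation. *)
Lemma graph_bound (s t : nat) (V : finType) (E : rel V) : 1 < s ->
  symmetric E -> irreflexive E ->
  (forall Z : {set V}, Hfree s t (fun u v => [&& E u v, u \in Z & v \notin Z])) ->
  (\sum_u \sum_v E u v) ^ (2 * s).+1 <= Cgraph s t * #|V| ^ (4 * s).
Proof.
move=> s2 sym irr hH; rewrite leqNgt; apply/negP => hV.
pose es (X : {set V}) := \sum_(u in X) \sum_(v in X) E u v.
pose viol (X : {set V}) := Cgraph s t * #|X| ^ (4 * s) < es X ^ (2 * s).+1.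
have hT : viol [set: V].
  rewrite /viol cardsT /es; under eq_bigl => u do rewrite inE.
  by under [X in _ < X ^ _]eq_bigr => u _ do under eq_bigl => v do rewrite inE.
have [X hX Xmin] : exists2 X, viol X & forall T, viol T -> #|X| <= #|T|.
  by case: (arg_minnP (fun T : {set V} => #|T|) hT) => X h1 h2; exists X.
set N := #|X| in Xmin; set e := es X.
pose deg u := \sum_(v in X) E u v.
have eE : e = \sum_(u in X) deg u by [].
have e0 : 0 < e by move: hX; rewrite /viol -/e; case: posnP => // ->; rewrite exp0n.
have degN u : deg u <= N.
  by rewrite /N -sum1_card; apply: leq_sum => v _; rewrite leq_b1.
have eN : e <= N ^ 2.
  by rewrite -mulnn {1}/N -[X in _ <= X]sum_nat_const; apply: leq_sum => u _; apply: degN.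
have hN : 256 <= N.
  rewrite -(@leq_exp2r _ _ 2) //; apply: leq_trans (leq_addl (8 ^ (2 * s).+1 * Ccore s t 2048) _) _.
  rewrite -/(Cgraph s t).
  have Np : 0 < N ^ (4 * s).
    rewrite expn_gt0; case: (posnP N) => // N0; move: eN; rewrite N0 leqn0 => /eqP e00.
    by rewrite e00 in e0.
  rewrite -(leq_pmul2r Np); apply: leq_trans (ltnW hX) _.
  rewrite -expnD; apply: leq_trans (leq_wexp2r _ eN) _.
  by rewrite -expnM leq_pexp2l //; [case: (N) Np => //; rewrite exp0n // muln_gt0; lia | lia].
have N0 : 0 < N by apply: leq_trans hN.
pose S := [set u in X | 256 * e < deg u * N].
have SX : S \subset X by apply/subsetP => u; rewrite inE => /andP [].
have cS : #|S| * 256 <= N.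
  rewrite -(leq_pmul2r e0).
  apply: (@leq_trans (\sum_(u in S) deg u * N)).
    rewrite -mulnA -sum_nat_const; apply: leq_sum => u; rewrite inE => /andP [_].
    exact: ltnW.
  rewrite -big_distrl /= [X in X <= _]mulnC leq_mul2l; apply/orP; right.
  by rewrite eE /= [X in _ <= X](big_setID S) /= (setIidPr SX) leq_addr.
pose dS := \sum_(u in S) deg u.
(* If S meets few edges, removing it keeps half of e and a cut keeps a quarter of that; degrees are
   then at most 256 e / N, hence at most 2048 times [eb] / N. *)
case: (leqP (4 * dS) e) => hS.
  pose X' := X :\: S.
  pose E1 u v := [&& E u v, u \in X' & v \in X'].
  have [|Z hZ] := @large_cut V E1; first by move=> u; rewrite /E1 irr.
  set eb := \sum_u \sum_v [&& E1 u v, _ & _] in hZ.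
  have he1 : e <= 2 * \sum_u \sum_v E1 u v.
    have dS1 : dS = \sum_u \sum_v [&& E u v, u \in S & v \in X] by rewrite -sum_setXE.
    have dS2 : dS = \sum_u \sum_v [&& E u v, u \in X & v \in S].
      rewrite dS1 exchange_big; apply: eq_bigr => v _; apply: eq_bigr => u _.
      by rewrite sym [(u \in S) && _]andbC.
    have : e <= \sum_u \sum_v E1 u v + (dS + dS).
      rewrite {1}dS1 dS2 /e /es sum_setXE -!big_split; apply: leq_sum => u _.
      rewrite -!big_split; apply: leq_sum => v _ /=; rewrite /E1 !in_setD.
      case: (E u v) => //=; case: (u \in X) => //=; case: (v \in X) => //=;
      by case: (u \in S); case: (v \in S).
    by move: hS; clear; lia.
  have he8 : e <= 8 * eb by move: hZ he1; clear; lia.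
  pose U : finType := {x : V | x \in X}.
  pose E2 (x z : U) := [&& E1 (val x) (val z), val x \in Z & val z \notin Z].
  have ebE : \sum_x \sum_z E2 x z = eb.
    rewrite /eb.
    transitivity (\sum_(u in X) \sum_(v in X) [&& E1 u v, u \in Z & v \notin Z]).
      by rewrite [RHS]big_sub; apply: eq_bigr => x _; rewrite [RHS]big_sub.
    rewrite (sum_setXE (fun u v => [&& E1 u v, u \in Z & v \notin Z])).
    apply: eq_bigr => u _; apply: eq_bigr => v _.
    rewrite /E1 !in_setD; case: (E u v) => //=.
    by case: (u \in X); case: (v \in X); rewrite ?andbF ?andbT.
  have cU : #|U| <= N by rewrite card_sig.
  pose D := 256 * e %/ N.
  have degX' u : u \in X' -> deg u <= D.
    rewrite !inE => /andP [h1 uX]; rewrite uX /= -leqNgt in h1.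
    by rewrite /D leq_divRL.
  have dA (x : U) : \sum_z E2 x z <= D.
    case: (boolP (val x \in X')) => hx; last first.
      by rewrite big1 // => z _; rewrite /E2 /E1 (negbTE hx) andbF.
    apply: leq_trans (degX' _ hx); rewrite /deg [X in _ <= X]big_sub; apply: leq_sum => z _.
    by rewrite /E2 /E1; case: (E _ _); rewrite ?leq_b1.
  have dB (z : U) : \sum_x E2 x z <= D.
    case: (boolP (val z \in X')) => hz; last first.
      by rewrite big1 // => x _; rewrite /E2 /E1 (negbTE hz) !andbF.
    apply: leq_trans (degX' _ hz); rewrite /deg [X in _ <= X]big_sub; apply: leq_sum => x _.
    by rewrite /E2 /E1 sym; case: (E _ _); rewrite ?leq_b1.
  have hF : Hfree s t E2.
    apply: Hfree_sub (Hfree_comp (f := val) (g := val) val_inj val_inj (hH Z)) _ _.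
    by move=> x z /and3P [/and3P [-> _ _] -> ->].
  have := @bipartite_bound s t 2048 s2 U U E2 D N cU cU dA dB.
  rewrite ebE => /(_ _ hF) hb.
  have {}hb : eb ^ (2 * s).+1 <= Ccore s t 2048 * N ^ (4 * s).
    apply: hb; apply: (@leq_trans (256 * e)); first exact: leq_divM.
    by move: he8; clear; lia.
  move: hX; rewrite /viol -/e ltnNge => /negP; apply.
  apply: leq_trans (leq_wexp2r _ he8) _; rewrite expnMn.
  apply: leq_trans (leq_mul (leqnn _) hb) _.
  by rewrite mulnA leq_mul2r /Cgraph leq_addr orbT.
(* Otherwise N/256 vertices with at least the average number of neighbours in S are joined to S; the
   resulting set spans at least e/2048. *)
pose phi v := \sum_(u in S) E u v.
have hphi : \sum_(v in X) phi v = dS by rewrite /phi exchange_big.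
have [|P [PX cP hP]] := @large_average_subset V phi X (N %/ 256); first exact: leq_div.
set h := N %/ 256 in cP hP.
have h1 : N <= 512 * h.
  have : 1 <= h by rewrite /h divn_gt0.
  have : N < h.+1 * 256 by rewrite ltn_ceil.
  by clear; lia.
pose T := S :|: P.
have cT : 128 * #|T| <= N.
  have aux (x y z w : nat) : y * 256 <= w -> z * 256 <= w -> x <= y + z -> 128 * x <= w.
    by clear; lia.
  by apply: (aux _ _ _ _ cS (leq_divM _ _)); rewrite -/h -cP leq_card_setU.
have eT : \sum_(v in P) phi v <= es T.
  rewrite /phi exchange_big /es !sum_setXE; apply: leq_sum => u _; apply: leq_sum => v _.
  rewrite /T !in_setU; case: (E u v) => //=; case: (u \in S) => //=.
  by case: (v \in P); rewrite ?orbT.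
have heT : e <= 2048 * es T.
  have : h * e <= h * (2048 * es T).
    rewrite hphi -/N in hP.
    have a1 := leq_mul (leqnn h) (ltnW hS).
    have a2 := leq_mul h1 eT.
    have aux (x y z w : nat) : x <= y * (4 * z) -> y * z <= 512 * y * w -> x <= y * (2048 * w).
      by clear; nia.
    exact: aux a1 (leq_trans hP a2).
  by rewrite leq_pmul2l // divn_gt0.
have nT : ~~ viol T.
  apply/negP => /Xmin; move: cT N0; clear; lia.
move: hX; rewrite /viol -/e ltnNge => /negP; apply.
apply: leq_trans (leq_wexp2r _ heT) _; rewrite expnMn.
rewrite /viol -leqNgt in nT.
apply: leq_trans (leq_mul (leqnn _) nT) _.
rewrite mulnCA leq_mul2l; apply/orP; right.
apply: leq_trans (leq_wexp2r (4 * s) cT); rewrite expnMn leq_mul2r; apply/orP; right.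
(* What remains is 11(2s + 1) <= 28s, true for s >= 2. *)
rewrite -[2048]/(2 ^ 11) -[128]/(2 ^ 7) -!expnM leq_pexp2l //.
by move: s2; clear; lia.
Qed.

(** * The extremal number *)

Definition edge_rel (V : finType) (G : {set {set V}}) : rel V :=
  fun u v => (u != v) && ([set u; v] \in G).

Lemma edge_rel_sym (V : finType) (G : {set {set V}}) : symmetric (edge_rel G).
Proof. by move=> u v; rewrite /edge_rel eq_sym setUC. Qed.

Lemma card_le_edge_rel (V : finType) (G : {set {set V}}) : is_graph G ->
  #|G| <= \sum_u \sum_v edge_rel G u v.
Proof.
move=> /forallP hG.
rewrite -(sum_prodE (fun p => edge_rel G p.1 p.2 : nat)) -big_mkcond /= sum1dep_card.
apply: leq_trans (leq_imset_card (fun p => [set p.1; p.2]) _).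
apply/subset_leq_card/subsetP => e eG.
have /implyP /(_ eG) /cards2P [u [v [nuv ee]]] := hG e.
by apply/imsetP; exists (u, v) => //; rewrite inE /edge_rel /= nuv -ee.
Qed.

(** The a_i and c_j lie in Z, the b_i and d_j outside; the only other coincidences, a_i = c_j and
    b_i = d_j, are excluded by [link]. *)
Lemma no_copy_Hfree (V : finType) (G : {set {set V}}) (s t : nat) :
  ~~ contains_copy G (Hst s t) -> forall Z : {set V},
  Hfree s t (fun u v => [&& edge_rel G u v, u \in Z & v \notin Z]).
Proof.
move=> hG Z a b u /and3P [/injectiveP ia /injectiveP ib /forallP hE] su u1 u2.
apply: contra hG => /allP hu.
have suP : size u == t by rewrite su.
pose w := Tuple suP.
have w1 : injective (fun j => (tnth w j).1).
  have : uniq (map_tuple fst w) by [].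
  by move/tuple_uniqP => h j k e; apply: h; rewrite !tnth_map.
have w2 : injective (fun j => (tnth w j).2).
  have : uniq (map_tuple snd w) by [].
  by move/tuple_uniqP => h j k e; apply: h; rewrite !tnth_map.
have hw j : link (fun u v => [&& edge_rel G u v, u \in Z & v \notin Z]) a b (tnth w j).
  exact/hu/mem_tnth.
pose f : {ffun Hst_vertex s t -> V} := [ffun x => match x with
  | inl (inl i) => a i | inl (inr i) => b i
  | inr (inl j) => (tnth w j).1 | inr (inr j) => (tnth w j).2 end].
have aZ i : a i \in Z by case/and3P: (hE i).
have bZ i : b i \notin Z by case/and3P: (hE i).
have cZ j : (tnth w j).1 \in Z by case/andP: (hw j) => /and3P [].
have dZ j : (tnth w j).2 \notin Z by case/andP: (hw j) => /and3P [].
have ac i j : a i != (tnth w j).1 by case/andP: (hw j) => _ /forallP /(_ i) /and4P [].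
have bd i j : b i != (tnth w j).2 by case/andP: (hw j) => _ /forallP /(_ i) /and4P [].
have ZN x y : x \in Z -> y \notin Z -> x <> y by move=> h1 h2 e; rewrite e (negbTE h2) in h1.
apply/existsP; exists f; apply/andP; split.
  apply/injectiveP; move=> [[i|i]|[j|j]] [[i'|i']|[j'|j']]; rewrite !ffunE.
  - by move/ia ->.
  - by move/ZN; case.
  - by move/eqP; rewrite (negbTE (ac _ _)).
  - by move/ZN; case.
  - by move/esym/ZN; case.
  - by move/ib ->.
  - by move/esym/ZN; case.
  - by move/eqP; rewrite (negbTE (bd _ _)).
  - by move/esym/eqP; rewrite (negbTE (ac _ _)).
  - by move/ZN; case.
  - by move/w1 ->.
  - by move/ZN; case.
  - by move/esym/ZN; case.
  - by move/esym/eqP; rewrite (negbTE (bd _ _)).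
  - by move/esym/ZN; case.
  - by move/w2 ->.
apply/forallP => e; apply/implyP.
have f2 x y : f @: [set x; y] = [set f x; f y] by rewrite imsetU1 imset_set1.
rewrite !inE => /orP [/orP [/orP [|]|]|].
- case/imsetP => i _ ->; rewrite f2 !ffunE.
  by case/and3P: (hE i) => /andP [].
- case/imsetP => j _ ->; rewrite f2 !ffunE.
  by case/andP: (hw j) => /and3P [/andP []].
- case/imset2P => i j _ _ ->; rewrite f2 !ffunE.
  by case/andP: (hw j) => _ /forallP /(_ i) /and4P [/and3P [/andP []]].
- case/imset2P => i j _ _ ->; rewrite f2 !ffunE setUC.
  by case/andP: (hw j) => _ /forallP /(_ i) /and4P [_ /and3P [/andP []]].
Qed.

Lemma ex_number_Hst_le (s t n : nat) : 1 < s ->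
  ex_number n (Hst s t) ^ (2 * s).+1 <= Cgraph s t * n ^ (4 * s).
Proof.
move=> s2.
apply: (big_ind (fun x => x ^ (2 * s).+1 <= Cgraph s t * n ^ (4 * s))).
- by rewrite exp0n.
- by move=> x y hx hy; case: (leqP x y).
move=> G /andP [gG cG].
apply: leq_trans (leq_wexp2r _ (card_le_edge_rel gG)) _.
have := @graph_bound s t 'I_n (edge_rel G) s2 (edge_rel_sym G) _ (no_copy_Hfree cG).
rewrite card_ord; apply => u.
by rewrite /edge_rel eqxx.
Qed.

From mathcomp Require Import all_boot all_order all_algebra.
From mathcomp Require Import all_classical all_reals all_analysis.
Import Order.TTheory GRing.Theory Num.Theory.
Import numFieldNormedType.Exports.
Local Open Scope classical_set_scope.
Local Open Scope ring_scope.

Theorem theorem1p6 (R : realType) (s t : nat) (hs : (2 <= s)%N) (hst : (s <= t)%N) :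
  (fun n : nat => (ex_number n (Hst s t))%:R : R^o) =O_\oo
    (fun n : nat => n%:R `^ (2 - 2 / (2 * s%:R + 1)) : R^o).
Proof.
(* No root of the constant is taken: a positive integer is at most its (2s+1)-st power, and the
   successor ensures positivity. *)
apply/eqO_exP; exists (Cgraph s t).+1%:R => //.
apply: nearW => n; rewrite ger0_norm ?ler0n // ger0_norm ?powR_ge0 //.
rewrite -(@ler_pXn2r _ (2 * s).+1) ?nnegrE ?mulr_ge0 ?ler0n ?powR_ge0 //.
have powE : ((n%:R : R) `^ (2 - 2 / (2 * s%:R + 1))) ^+ (2 * s).+1 = (n ^ (4 * s))%:R.
  rewrite -powR_mulrn ?powR_ge0 // -powRrM natrX -powR_mulrn ?ler0n //.
  congr (_ `^ _).
  have s1 : (2 * s%:R + 1 : R) != 0 by rewrite -natrM natr1 pnatr_eq0.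
  have -> : ((2 * s).+1%:R : R) = 2 * s%:R + 1 by rewrite -natr1 natrM.
  rewrite mulrBl mulfVK // mulrDr mulr1 addrK mulrA -!natrM.
  by [].
rewrite exprMn powE -!natrX -natrM ler_nat.
apply: leq_trans (ex_number_Hst_le t n hs) _.
rewrite leq_mul2r; apply/orP; right; apply: leq_trans (leqnSn _) _.
by rewrite -{1}(expn1 (Cgraph s t).+1) leq_pexp2l.
Qed.
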